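(* Let $q$ be a power of $2$. In $\mathrm{PG}(3,q^2)$ let $\mathcal H$ be a non-degenerate Hermitian surface and let $\mathcal Q$ be an irreducible quadric such that $\mathcal H$ and $\mathcal Q$ have the same tangent plane at at least one common non-singular point $P$. Then the size $|\mathcal H\cap\mathcal Q|$ is one of the following: \begin{itemize} \item if $\mathcal Q$ is elliptic: $q^3-q^2+1,\ q^3-q^2+q+1,\ q^3-q+1,\ q^3+1,\ q^3+q+1,\ q^3+q^2-q+1,\ q^3+q^2+1$; \item if $\mathcal Q$ is a quadratic cone: $q^3-q^2+q+1,\ q^3-q+1,\ q^3+q+1,\ q^3+q^2-q+1,\ q^3+2q^2-q+1$; \item if $\mathcal Q$ is hyperbolic: $q^2+1,\ q^3-q^2+1,\ q^3-q^2+q+1,\ q^3-q+1,\ q^3+1,\ q^3+q+1,\ q^3+q^2-q+1,\ q^3+q^2+1,\ q^3+2q^2-q+1,\ q^3+2q^2+1,\ q^3+3q^2-q+1,\ 2q^3+q^2+1$. \end{itemize}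
   Context: An irreducible quadric of $\mathrm{PG}(3,q^2)$ is either a non-degenerate quadric (elliptic or hyperbolic) or a quadratic cone, i.e. the quadric projecting an irreducible conic contained in a plane $\pi$ from a vertex $V\notin\pi$. *)

(* Defs.v *)
From mathcomp Require Import all_boot all_order all_algebra all_field.
Set Implicit Arguments. Unset Strict Implicit. Unset Printing Implicit Defensive.
Import GRing.Theory.
Local Open Scope ring_scope.

Section PG3.
Variable F : finFieldType.

(* Points of PG(3,F) are represented by nonzero vectors of F^4 = 'rV[F]_4. *)
Definition coord (x : 'rV[F]_4) (i : 'I_4) : F := x 0 i.

(* The quadratic form with (not necessarily symmetric) coefficient matrix A:
   Q(x) = sum_{i,j} A_ij x_i x_j.  Every quadratic form in 4 variables arises so. *)
Definition qform (A : 'M[F]_4) (x : 'rV[F]_4) : F :=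
  \sum_(i < 4) \sum_(j < 4) A i j * coord x i * coord x j.

Definition qgrad (A : 'M[F]_4) (x : 'rV[F]_4) (i : 'I_4) : F :=
  \sum_(j < 4) (A i j + A j i) * coord x j.

(* Hermitian form with matrix A relative to the involution t |-> t^q of GF(q^2):
   H(x) = sum_{i,j} A_ij x_i x_j^q. *)
Definition hform (q : nat) (A : 'M[F]_4) (x : 'rV[F]_4) : F :=
  \sum_(i < 4) \sum_(j < 4) A i j * coord x i * (coord x j) ^+ q.

Definition hermitian_mx (q : nat) (A : 'M[F]_4) : Prop :=
  forall i j, A j i = (A i j) ^+ q.

Definition nondeg_hermitian (q : nat) (A : 'M[F]_4) : Prop :=
  hermitian_mx q A /\ \det A != 0.

(* Coefficients of the tangent plane of the Hermitian surface at x: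
   the plane sum_i (sum_j A_ij x_j^q) y_i = 0. *)
Definition hgrad (q : nat) (A : 'M[F]_4) (x : 'rV[F]_4) (i : 'I_4) : F :=
  \sum_(j < 4) A i j * (coord x j) ^+ q.

Definition proj_equiv (A : 'M[F]_4) (canon : 'rV[F]_4 -> F) : Prop :=
  exists (M : 'M[F]_4) (c : F), M \in unitmx /\ c != 0 /\
    forall x : 'rV[F]_4, qform A (x *m M) = c * canon x.

Definition x_ (x : 'rV[F]_4) (k : nat) : F := coord x (inord k).

(* Canonical forms of the irreducible quadrics of PG(3,F) (Hirschfeld). *)
Definition hyperbolic_quadric (A : 'M[F]_4) : Prop :=
  proj_equiv A (fun x => x_ x 0 * x_ x 1 + x_ x 2 * x_ x 3).

Definition elliptic_quadric (A : 'M[F]_4) : Prop :=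
  exists d : F, irreducible_poly ('X^2 + 'X + d%:P) /\
    proj_equiv A (fun x => x_ x 0 * x_ x 1 + x_ x 2 ^+ 2 + x_ x 2 * x_ x 3
                           + d * x_ x 3 ^+ 2).

Definition quadratic_cone (A : 'M[F]_4) : Prop :=
  proj_equiv A (fun x => x_ x 0 * x_ x 1 + x_ x 2 ^+ 2).

Definition irreducible_quadric (A : 'M[F]_4) : Prop :=
  elliptic_quadric A \/ hyperbolic_quadric A \/ quadratic_cone A.

Definition nonsingular_qpoint (A : 'M[F]_4) (P : 'rV[F]_4) : Prop :=
  P != 0 /\ qform A P = 0 /\ exists i, qgrad A P i != 0.

Definition same_tangent_plane (q : nat) (H A : 'M[F]_4) (P : 'rV[F]_4) : Prop :=
  exists c : F, c != 0 /\ forall i, qgrad A P i = c * hgrad q H P i.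

Definition n_common_points (q : nat) (H A : 'M[F]_4) : nat :=
  (#|[set v : 'rV[F]_4 | (v != 0%R) && (hform q H v == 0%R) && (qform A v == 0%R)]|
     %/ (#|F| - 1))%N.

End PG3.

(* Main.v *)
Require Import Defs.
From mathcomp Require Import all_boot all_order all_algebra all_field.
From mathcomp Require Import zify ring.
Set Implicit Arguments. Unset Strict Implicit. Unset Printing Implicit Defensive.
Import GRing.Theory.
Local Open Scope ring_scope.

(** Write Tr and N for the trace and norm of GF(q^2) over GF(q). Since the tangent planes at P agree,
    a basis starting with P and adapted to the Hermitian form gives coordinates (t, s, x, y)
    in which H = Tr (t s^q) + N x + N y and Q = t s + f s^2 + s (d x + e y) + a x^2 + c x y + b y^2.
    The common points with s = 0 are P and the points other than P of k lines through P, where k is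
    the number of m with N m = 1 and a + c m + b m^2 = 0. Those with s = 1 correspond to the n zeros
    (x, y) of Tr (f + d x + e y + a x^2 + c x y + b y^2) + N x + N y, a quadratic polynomial on a
    4-dimensional GF(q)-space, so there are n + 1 + q^2 k common points.
    If N c <> 1 the quadratic part is nondegenerate, and the second moment of its fibre sizes leaves
    two possibilities. If N c = 1 its radical has dimension 2, and the additive polynomial
    Tr (rho x^2 + delta x), where rho = a + c^2 b^q and delta = d + c e^q, splits off.
    The type of Q restricts (a, b, c): an elliptic quadric contains no line, so a x^2 + c x y + b y^2
    is anisotropic; the polar form of Q is nondegenerate if and only if c <> 0. *)

(** * Double counting over finite types *)

Lemma sum_pred1 (T : finType) (a : T) : \sum_x (a == x : nat) = 1%N.
Proof. by rewrite (bigD1 a) //= eqxx big1 // => x; rewrite eq_sym => /negPf ->. Qed.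

Lemma sum_fibers (T U : finType) (f : T -> U) (P : pred T) :
  (\sum_u \sum_x (P x && (f x == u)) = \sum_x P x)%N.
Proof.
rewrite exchange_big; apply: eq_bigr => x _ /=.
case: (P x) => /=; first exact: sum_pred1.
by rewrite big1.
Qed.

Lemma card_fibers (T U : finType) (f : T -> U) :
  (\sum_u \sum_x (f x == u) = #|T|)%N.
Proof. by rewrite (sum_fibers f xpredT) sum1_card. Qed.

Lemma second_moment (T U : finType) (f : T -> U) :
  (\sum_u (\sum_x (f x == u)) ^ 2 = \sum_x \sum_y (f x == f y))%N.
Proof.
transitivity (\sum_u \sum_x \sum_y ((f x == u) * (f y == u)))%N.
  by apply: eq_bigr => u _; rewrite -mulnn big_distrlr.
rewrite exchange_big; apply: eq_bigr => x _; rewrite exchange_big; apply: eq_bigr => y _.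
rewrite (bigD1 (f x)) //= eqxx mul1n eq_sym big1 ?addn0 // => u.
by rewrite eq_sym => /negPf->.
Qed.

Lemma sum_cond_const (T : finType) (B : pred T) m :
  (\sum_(u | B u) m = m * \sum_u B u)%N.
Proof.
by rewrite big_distrr /= big_mkcond; apply: eq_bigr => u _; case: (B u); rewrite ?muln1 ?muln0.
Qed.

(** A single value below [m] would push the sum below [m] times the number of indices. This turns
    bounds from root counting into exact fibre sizes. *)
Lemma eq_bound_of_sum (T : finType) (B : pred T) (n : T -> nat) m :
  (forall u, B u -> n u <= m)%N -> (m * \sum_u B u <= \sum_(u | B u) n u)%N ->
  forall u, B u -> n u = m.
Proof.
rewrite -sum_cond_const => le_n le_m u Bu.
apply/eqP; rewrite eqn_leq le_n //= leqNgt; apply/negP => lt_n.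
suff: (\sum_(u | B u) n u < \sum_(u | B u) m)%N by rewrite ltnNge le_m.
rewrite (bigD1 u) //= [X in (_ < X)%N](bigD1 u) //= -addSn.
by apply: leq_add => //; apply: leq_sum => v /andP [Bv _]; apply: le_n.
Qed.

Lemma count_roots_le (F : finFieldType) (p : {poly F}) n :
  p != 0 -> (size p <= n.+1)%N -> (\sum_x root p x <= n)%N.
Proof.
move=> p0 sp.
have -> : (\sum_x root p x = size (enum (root p)))%N.
  by rewrite -cardE -sum1_card [RHS]big_mkcond; apply: eq_bigr.
rewrite -ltnS; apply: leq_trans sp; apply: max_poly_roots (enum_uniq _) => //.
by apply/allP => x; rewrite mem_enum.
Qed.

Local Notation "\count_ x P" := (\big[addn/0%N]_x nat_of_bool P%R)
  (at level 41, P at level 41, x at level 0).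

Lemma count_le1 (T : finType) (P : pred T) :
  (forall x y, P x -> P y -> x = y) -> (\sum_x P x <= 1)%N.
Proof.
move=> Pu; case: (pickP P) => [x Px|P0]; last by rewrite big1 // => x _; rewrite P0.
rewrite -(sum_pred1 x); apply: leq_sum => y _.
by case Py: (P y) => //; rewrite (Pu x y) ?eqxx.
Qed.

(** * Conjugation, trace and norm of GF(q^2) over GF(q) in characteristic 2 *)

Section HermitianCounts.
Variables (F : finFieldType) (q h : nat).
Hypotheses (hq : q = (2 ^ h)%N) (hF : #|F| = (q ^ 2)%N).

Lemma h_gt0 : (0 < h)%N.
Proof.
case: h hq => // q1; have := finNzRing_gt1 F.
by rewrite hF q1.
Qed.

Lemma q_gt1 : (1 < q)%N.
Proof. by rewrite hq -{1}(expn0 2) ltn_exp2l ?h_gt0. Qed.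

Lemma pchar2 : 2%N \in [pchar F].
Proof. by apply: (@card_finPcharP F 2 (h * 2)) => //; rewrite hF hq -expnM. Qed.

Lemma even_numerals_eq0 : [/\ 2 = 0 :> F, 4 = 0 :> F, 6 = 0 :> F, 8 = 0 :> F & 10 = 0 :> F].
Proof.
have e n : n.*2%:R = 0 :> F by rewrite -muln2 natrM (pcharf0 pchar2) mulr0.
by split; [apply: (e 1%N) | apply: (e 2%N) | apply: (e 3%N) | apply: (e 4%N) | apply: (e 5%N)].
Qed.

Lemma addxx (x : F) : x + x = 0.
Proof. exact: (addrr_pchar2 pchar2). Qed.

Lemma addr_eq0_char2 (x y : F) : (x + y == 0) = (x == y).
Proof. by rewrite -[y in LHS](oppr_pchar2 pchar2) subr_eq0. Qed.

Lemma eq_char2 (x y : F) : x + y = 0 -> x = y.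
Proof. by move/eqP; rewrite addr_eq0_char2 => /eqP. Qed.

(* [ring] does not reduce numerals modulo 2: the two sides are added, and the
   vanishing of the even coefficients is passed to it as equations. *)
Ltac char2_with H := apply: eq_char2;
  let e2 := fresh in let e4 := fresh in let e6 := fresh in
  let e8 := fresh in let e10 := fresh in
  have [e2 e4 e6 e8 e10] := even_numerals_eq0; ring: H e2 e4 e6 e8 e10.

Ltac char2 := char2_with (erefl (0 : F)).

Definition cj (x : F) : F := x ^+ q.
Definition Tr (x : F) : F := x + cj x.
Definition N (x : F) : F := x * cj x.

Lemma cjD x y : cj (x + y) = cj x + cj y.
Proof.
by apply: exprDn_pchar; rewrite hq pnatX (eq_pnat _ (pcharf_eq pchar2)) pnat_id.
Qed.
Lemma cjM x y : cj (x * y) = cj x * cj y. Proof. exact: exprMn. Qed.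
Lemma cjK x : cj (cj x) = x.
Proof. by rewrite /cj -exprM mulnn -hF expf_card. Qed.
Lemma cj0 : cj 0 = 0.
Proof. by rewrite /cj expr0n gtn_eqF // ltnW // q_gt1. Qed.
Lemma cj1 : cj 1 = 1. Proof. exact: expr1n. Qed.
Lemma cjX x n : cj (x ^+ n) = cj x ^+ n.
Proof. by rewrite /cj -!exprM mulnC. Qed.
Lemma cjV x : cj x^-1 = (cj x)^-1. Proof. exact: exprVn. Qed.
Lemma cj_inj : injective cj. Proof. exact: can_inj cjK. Qed.
Lemma cj_eq0 x : (cj x == 0) = (x == 0).
Proof. by rewrite -{1}cj0 (inj_eq cj_inj). Qed.
Definition cjE := (cjD, cjM, cjX, cjK, cj0, cj1).

Lemma cjTr x : cj (Tr x) = Tr x.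
Proof. by rewrite /Tr !cjE addrC. Qed.
Lemma cjN x : cj (N x) = N x.
Proof. by rewrite /N !cjE mulrC. Qed.
Lemma N_cj x : N (cj x) = N x.
Proof. by rewrite /N cjK mulrC. Qed.
Lemma NM x y : N (x * y) = N x * N y.
Proof. by rewrite /N cjM mulrACA. Qed.
Lemma N_eq0 x : (N x == 0) = (x == 0).
Proof. by rewrite /N mulf_eq0 cj_eq0 orbb. Qed.
Lemma Tr0 : Tr 0 = 0. Proof. by rewrite /Tr cj0 addr0. Qed.
Lemma N0 : N 0 = 0. Proof. by rewrite /N mul0r. Qed.

(** * Kernel and fibres of the additive map x + nu x^q *)

Section Twist.
Variables (nu : F) (N_nu : N nu = 1).

Let nu0 : nu != 0.
Proof. by rewrite -N_eq0 N_nu oner_neq0. Qed.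

Lemma count_twist_le : (\count_x (x + nu * cj x == 0) <= q)%N.
Proof.
pose p : {poly F} := nu *: 'X^q + 'X.
have sp : size p = q.+1.
  by rewrite size_polyDl size_scale // ?size_polyXn // size_polyX ltnS q_gt1.
have p0 : p != 0 by rewrite -size_poly_eq0 sp.
apply: leq_trans (@count_roots_le F p _ p0 (eq_leq sp)).
by apply: leq_sum => x _; rewrite rootE /p !hornerE addrC.
Qed.

Lemma count_twist_fiber_le y : (\count_x (x + nu * cj x == y) <= q)%N.
Proof.
case: (pickP (fun x => x + nu * cj x == y)) => [x0 /eqP <-|n0]; last by rewrite big1 // => x _;
  rewrite n0.
rewrite (reindex_inj (addIr x0)); apply: leq_trans count_twist_le.
by apply: leq_sum => x _; rewrite cjD mulrDr addrACA -subr_eq0 addrK.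
Qed.

Lemma twist_im x : cj (x + nu * cj x) * nu = x + nu * cj x.
Proof.
have := N_nu; rewrite /N !cjE mulrDl => e.
by rewrite addrC mulrAC [cj nu * nu]mulrC e mul1r mulrC.
Qed.

Lemma twist_imE y : (y + nu * cj y == 0) = (cj y * nu == y).
Proof. by rewrite addr_eq0_char2 eq_sym mulrC. Qed.

Lemma sum_twist_fibers :
  (\sum_(y | (cj y * nu == y)%R) \count_x (x + nu * cj x == y) = q * q)%N.
Proof.
rewrite mulnn -hF -(card_fibers (fun x => x + nu * cj x)) [LHS]big_mkcond.
apply: eq_bigr => y _; case: ifP => // y0; apply/esym/big1 => x _ /=.
by case: eqP => // e; rewrite -e twist_im eqxx in y0.
Qed.

(** In characteristic 2 the equation of the kernel also holds on the image ([twist_imE],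
    [twist_im]). The fibres over its solutions have at most q elements each and cover all q^2
    elements, so the kernel has at least q. *)
Lemma count_twist : (\count_x (x + nu * cj x == 0) = q)%N.
Proof.
apply/eqP; rewrite eqn_leq count_twist_le /=.
have q0 : (0 < q)%N by apply: ltnW q_gt1.
rewrite -(leq_pmul2l q0) -{1}sum_twist_fibers.
rewrite (eq_bigr _ (fun x _ => congr1 nat_of_bool (twist_imE x))) -sum_cond_const.
by apply: leq_sum => y _; apply: count_twist_fiber_le.
Qed.

Lemma count_twist_fiber y : cj y * nu = y -> (\count_x (x + nu * cj x == y) = q)%N.
Proof.
move=> /eqP; move: y; apply: eq_bound_of_sum => [y _|]; first exact: count_twist_fiber_le.
rewrite sum_twist_fibers leq_mul2l -[X in (_ <= X)%N]count_twist; apply/orP; right.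
by apply: leq_sum => y _; rewrite twist_imE.
Qed.

End Twist.

(** * Fibre sizes of the trace and the norm *)

Lemma count_Fq : (\count_x (cj x == x) = q)%N.
Proof.
have N1 : N 1 = 1 by rewrite /N cj1 mul1r.
by rewrite -[RHS](count_twist N1); apply: eq_bigr => x _; rewrite mul1r addr_eq0_char2 eq_sym.
Qed.

Lemma count_Tr t : cj t = t -> (\count_x (Tr x == t) = q)%N.
Proof.
move=> ht; have N1 : N 1 = 1 by rewrite /N cj1 mul1r.
rewrite -[RHS](@count_twist_fiber _ N1 t) ?mulr1 //.
by apply: eq_bigr => x _; rewrite mul1r.
Qed.

Lemma count_Tr_mul w t : w != 0 -> cj t = t -> (\count_x (Tr (w * x) == t) = q)%N.
Proof. by move=> w0 ht; rewrite -[RHS](count_Tr ht) [RHS](reindex_inj (mulfI w0)). Qed.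

Lemma count_N0 : (\count_x (N x == 0) = 1)%N.
Proof. by rewrite -[RHS](sum_pred1 (0 : F)); apply: eq_bigr => x _; rewrite N_eq0 eq_sym. Qed.

(** Root counting bounds each fibre by q + 1, and the q - 1 nonzero elements of GF(q) must account
    for all q^2 - 1 nonzero elements of the field. *)
Lemma count_N t : cj t = t -> t != 0 -> (\count_x (N x == t) = q.+1)%N.
Proof.
move=> ht t0.
have := @eq_bound_of_sum F [pred u | (cj u == u) && (u != 0)] (fun u => \count_x (N x == u))%N q.+1.
apply => [u _||]; last by rewrite /= ht eqxx.
  pose p : {poly F} := 'X^(q.+1) - u%:P.
  have sp : size p = q.+2 by rewrite size_XnsubC.
  have p0 : p != 0 by rewrite -size_poly_eq0 sp.
  apply: leq_trans (@count_roots_le F p _ p0 (eq_leq sp)).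
  by apply: leq_sum => x _; rewrite rootE /p !hornerE exprS subr_eq0.
have q1 := q_gt1.
have e1 : (\sum_(u : F) [pred u | ((cj u == u) && (u != 0))%R] u = q - 1)%N.
  rewrite -[in RHS]count_Fq (bigD1 (0 : F)) //= [in RHS](bigD1 (0 : F)) //= cj0 !eqxx addKn add0n.
  by apply: eq_bigr => u /negPf->; rewrite andbT.
have e2 : (\sum_(u | [pred u | ((cj u == u) && (u != 0))%R] u) \count_x (N x == u) + 1 = q * q)%N.
  rewrite mulnn -hF -(card_fibers N) [RHS](bigD1 (0 : F)) //= count_N0 addnC; congr addn.
  rewrite [RHS]big_mkcond [LHS]big_mkcond; apply: eq_bigr => u _.
  rewrite andbC; case: (u == 0) => //=; case: eqP => // hu.
  apply/esym/big1 => x _; case: eqP => // e; case: hu.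
  by rewrite -e cjN.
by rewrite e1; nia.
Qed.

(** * Square roots and Artin-Schreier equations *)

Lemma sqr_char2D (x y : F) : (x + y) ^+ 2 = x ^+ 2 + y ^+ 2.
Proof. by char2. Qed.

Lemma sqr_inj : injective (fun x : F => x ^+ 2).
Proof.
by move=> x y /eqP; rewrite -addr_eq0_char2 -sqr_char2D sqrf_eq0 addr_eq0_char2 => /eqP.
Qed.

Lemma exists_sqrt (x : F) : exists y, y ^+ 2 = x.
Proof. by have [g _ gK] := injF_bij sqr_inj; exists (g x); rewrite gK. Qed.

Lemma count_quad_le (a b : F) : (\count_z (z ^+ 2 + a * z == b) <= 2)%N.
Proof.
pose p : {poly F} := 'X^2 + (a *: 'X - b%:P).
have sl : (size (a *: 'X - b%:P)%R < 3)%N.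
  rewrite ltnS; apply: leq_trans (size_polyD _ _) _.
  rewrite size_polyN geq_max (leq_trans (size_scale_leq _ _)) ?size_polyX //.
  by apply: leq_trans (size_polyC_leq1 _) _.
have sp : size p = 3%N by rewrite size_polyDl size_polyXn.
have p0 : p != 0 by rewrite -size_poly_eq0 sp.
apply: leq_trans (@count_roots_le F p _ p0 (eq_leq sp)).
by apply: leq_sum => x _; rewrite rootE /p !hornerE -subr_eq0 ?addrA.
Qed.

(* The fibres over GF(q) have at most 2 elements and cover the [2 q] elements of trace 0 or 1. *)
Lemma artin_schreier t : cj t = t -> (\count_z (z ^+ 2 + z == t) = 2)%N.
Proof.
move=> /eqP; move: t.
apply: (@eq_bound_of_sum F (fun t => cj t == t) (fun t => \count_z (z ^+ 2 + z == t))) => [t _|].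
  apply: leq_trans (count_quad_le 1 t); apply: leq_sum => z _; by rewrite mul1r.
pose f (z : F) : F := z ^+ 2 + z.
have -> : (\sum_(u | (cj u == u)%R) \count_z (z ^+ 2 + z == u) = \count_z (cj (f z) == f z))%N.
  rewrite -(sum_fibers f (fun z => cj (f z) == f z)) big_mkcond; apply: eq_bigr => u _.
  case: ifP => hu; last first.
    by apply/esym/big1 => z _; case: (f z =P u) => [->|]; rewrite ?hu ?andbF.
  by apply: eq_bigr => z _; rewrite -/(f z); case: (f z =P u) => [->|]; rewrite ?hu ?andbF.
rewrite count_Fq mul2n -addnn -{1}(count_Tr cj0) -{1}(count_Tr cj1) -big_split /=.
apply: leq_sum => z _; rewrite -[cj (f z) == _]addr_eq0_char2.
have -> : cj (f z) + f z = Tr z * (Tr z + 1) by rewrite /f /Tr !cjE; char2.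
by rewrite mulf_eq0 [Tr z + 1 == 0]addr_eq0_char2; have [->|_] := eqVneq (Tr z) 0;
  rewrite // eq_sym oner_eq0.
Qed.

Lemma artin_schreier_root t : cj t = t -> exists z, z ^+ 2 + z = t.
Proof.
move=> /artin_schreier; case: (pickP (fun z : F => z ^+ 2 + z == t)) => [z /eqP|n0];
  first by exists z.
by rewrite big1 // => z _; rewrite n0.
Qed.

Lemma sum_Tr (g : F -> nat) : (\sum_x g (Tr x) = q * \sum_(t | (cj t == t)%R) g t)%N.
Proof.
rewrite (partition_big Tr (fun t => cj t == t)) /= => [|x _]; last by rewrite cjTr.
rewrite big_distrr /=; apply: eq_bigr => t /eqP /count_Tr e.
rewrite -{1}e big_distrl /= big_mkcond; apply: eq_bigr => x _.
by case: eqP => [->|]; rewrite ?mul1n ?mul0n.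
Qed.

Lemma count_Tr2 (r s t : F) : (r != 0) || (s != 0) -> cj t = t ->
  (\sum_x \count_y (Tr (r * x) + Tr (s * y) == t) = q ^ 3)%N.
Proof.
move=> rs ht.
wlog s0 : r s rs / s != 0 => [W|].
  case/orP: (rs) => [r0|]; last exact: W.
  rewrite exchange_big -[RHS](W s r) //; last by rewrite orbC.
  by apply: eq_bigr => x _; apply: eq_bigr => y _; rewrite addrC.
rewrite (eq_bigr (fun => q)) => [|x _].
  by rewrite sum_nat_const hF -expnSr.
rewrite -[RHS](@count_Tr_mul s (t + Tr (r * x))) //; last by rewrite cjD ht cjTr.
by apply: eq_bigr => y _; rewrite -[_ == t]addr_eq0_char2 -[_ == t + _]addr_eq0_char2;
  congr (nat_of_bool (_ == _)); char2.
Qed.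

(** * Fibres of quadratic forms over GF(q) *)

Section QuadraticFibers.
Variables (T : finType) (f : T -> F) (sc : F -> T -> T).
Hypothesis cj_f : forall v, cj (f v) = f v.
Hypothesis sc_inj : forall l, l != 0 -> injective (sc l).
Hypothesis f_sc : forall l v, cj l = l -> f (sc l v) = l ^+ 2 * f v.

Lemma fiber_nonFq t : cj t != t -> (\count_v (f v == t) = 0)%N.
Proof. by move=> ht; apply: big1 => v _; case: eqP => // e; rewrite -e cj_f eqxx in ht. Qed.

(** In characteristic 2 every t in GF(q) is l^2 with l in GF(q), and scaling by l carries the fibre
    over 1 onto the fibre over t. *)
Lemma fiber_scale t : cj t = t -> t != 0 -> (\count_v (f v == t) = \count_v (f v == 1))%N.
Proof.
move=> ht t0; have [l lt] := exists_sqrt t.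
have hl : cj l = l by apply: sqr_inj; rewrite /= -cjX lt.
have l0 : l != 0 by rewrite -sqrf_eq0 lt.
rewrite (reindex_inj (sc_inj l0)); apply: eq_bigr => v _.
by rewrite f_sc // lt -{2}(mulr1 t) (inj_eq (mulfI t0)).
Qed.

(** The condition on [g] discards the empty fibres outside GF(q). Taking [g] to be the identity or
    the square gives the first or second moment. *)
Lemma fiber_sum_with (g : nat -> nat) : g 0%N = 0%N ->
  (\sum_t g (\count_v (f v == t)) = g (\count_v (f v == 0)) + (q - 1) * g (\count_v (f v == 1)))%N.
Proof.
move=> g0; rewrite (bigD1 (0 : F)) //=; congr addn.
have -> : (q - 1 = \sum_(t | (t != 0)%R) (cj t == t)%R)%N.
  by rewrite -count_Fq (bigD1 (0 : F)) //= cj0 eqxx addKn.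
rewrite big_distrl; apply: eq_bigr => t t0 /=.
by have [/fiber_scale -> //|/eqP /fiber_nonFq ->] := cj t =P t; rewrite ?g0 ?mul1n.
Qed.

Lemma fiber_sum : (\count_v (f v == 0) + (q - 1) * (\count_v (f v == 1)) = #|T|)%N.
Proof. by rewrite -(card_fibers f) (fiber_sum_with (g := id)). Qed.

End QuadraticFibers.

(** * The quadratic form on the 4-dimensional GF(q)-space of pairs (x, y) *)

Section Form.
Variables a b c : F.

Definition affine_form (v : F * F) : F :=
  Tr (a * v.1 ^+ 2 + c * v.1 * v.2 + b * v.2 ^+ 2) + N v.1 + N v.2.

Definition form_fiber (t : F) : nat := \count_v (affine_form v == t).

Arguments form_fiber t%_R.

Lemma cj_affine_form v : cj (affine_form v) = affine_form v.
Proof. by rewrite /affine_form 2!cjD cjTr !cjN. Qed.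

(* The polar form of [affine_form] is [Tr (polar1 w * v.1) + Tr (polar2 w * v.2)]. *)
Definition polar1 (w : F * F) := c * w.2 + cj w.1.
Definition polar2 (w : F * F) := c * w.1 + cj w.2.

Lemma affine_formD v w :
  affine_form (v + w) = affine_form v + affine_form w + (Tr (polar1 w * v.1) + Tr (polar2 w * v.2)).
Proof. by rewrite /affine_form /polar1 /polar2 /Tr /N /= !cjE; char2. Qed.

Lemma affine_formZ l v : cj l = l -> affine_form (l * v.1, l * v.2) = l ^+ 2 * affine_form v.
Proof. by move=> hl; rewrite /affine_form /Tr /N /= !cjE !hl; ring. Qed.

Let scale2 (l : F) (v : F * F) := (l * v.1, l * v.2).

Let scale2_inj l : l != 0 -> injective (scale2 l).
Proof. by move=> l0 [x y] [x' y'] [/(mulfI l0) -> /(mulfI l0) ->]. Qed.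

Lemma form_fiber_cases t : cj t = t -> form_fiber t = form_fiber 0 \/ form_fiber t = form_fiber 1.
Proof.
move=> ht; have [->|t0] := eqVneq t 0; first by left.
by right; apply: (fiber_scale scale2_inj _ ht t0) => l v; apply: affine_formZ.
Qed.

Lemma form_fiber_sum : (form_fiber 0 + (q - 1) * form_fiber 1 = q ^ 4)%N.
Proof. by rewrite (fiber_sum cj_affine_form scale2_inj affine_formZ) card_prod hF -expnD. Qed.

Hypothesis Nc : N c != 1.

(** If both components vanish, then x^q = c y and y^q = c x, so y = N(c) y; as N(c) is not 1, y and
    then x are zero. *)
Lemma polar_neq0 w : w != 0 -> (polar1 w != 0) || (polar2 w != 0).
Proof.
rewrite -negb_and; apply: contra => /andP []; rewrite /polar1 /polar2.
case: w => x y /=; rewrite !addr_eq0_char2 => /eqP e1 /eqP e2.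
have y0 : y = 0.
  have : (N c + 1) * y = 0.
    have e3 : c * cj c * y = y.
      apply: cj_inj; rewrite -e2 !cjE -[x]cjK -e1 !cjE; ring.
    by rewrite /N mulrDl mul1r e3 addxx.
  by move/eqP; rewrite mulf_eq0 addr_eq0_char2 (negPf Nc) => /eqP.
by move: e1; rewrite y0 mulr0 => /esym /eqP; rewrite cj_eq0 => /eqP ->.
Qed.

(* For [w != 0], [v] and [v + w] have the same value for exactly [q ^ 3] vectors [v]. *)
Lemma form_fiber_second_moment :
  (form_fiber 0 ^ 2 + (q - 1) * form_fiber 1 ^ 2 = q ^ 4 + (q ^ 4 - 1) * q ^ 3)%N.
Proof.
have cV : (#|{: F * F}| = q ^ 4)%N by rewrite card_prod hF -expnD.
rewrite -[LHS](@fiber_sum_with _ _ _ cj_affine_form scale2_inj affine_formZ (fun n => n ^ 2)%N) //.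
rewrite second_moment.
transitivity (\sum_(w : F * F) \count_v (Tr (polar1 w * v.1) +
  Tr (polar2 w * v.2) == affine_form w))%N.
  rewrite [RHS]exchange_big; apply: eq_bigr => v _.
  rewrite (reindex_inj (addrI v)); apply: eq_bigr => w _ /=.
  rewrite affine_formD -addrA -{1}[affine_form v]addr0 (inj_eq (addrI _)).
  by rewrite eq_sym addr_eq0_char2 eq_sym.
rewrite (bigD1 (0 : F * F)) //=; congr addn.
  rewrite -cV -sum1_card; apply: eq_bigr => v _.
  by rewrite /affine_form /polar1 /polar2 /= !expr0n /= !(mulr0, addr0, cj0, mul0r, Tr0, N0) eqxx.
rewrite (eq_bigr (fun => q ^ 3)%N) => [|w w0].
  by rewrite sum_nat_const cardC1 cV subn1.
rewrite -[RHS](@count_Tr2 _ _ (affine_form w) (polar_neq0 w0)) ?cj_affine_form //.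
by rewrite pair_big.
Qed.

(** Eliminating the fibre over 0 from the two moments leaves (m - q^3 - q)(m - q^3 + q) = 0 for the
    size m of the fibre over 1. The first alternative is the hyperbolic type of a quaternary form
    over GF(q), the second the elliptic type. *)
Lemma form_fiber_sizes :
  (form_fiber 0 + q = q ^ 3 + q ^ 2 /\ form_fiber 1 + q = q ^ 3)%N \/
  (form_fiber 0 + q ^ 2 = q ^ 3 + q /\ form_fiber 1 = q ^ 3 + q)%N.
Proof.
move: form_fiber_sum form_fiber_second_moment; move: (form_fiber 0) (form_fiber 1) => Z m.
have : (1 < q)%N := q_gt1.
(* Writing q as p + 1 removes the truncated subtraction before passing to integers. *)
case: (q) => [//|p]; rewrite ltnS => p0; rewrite subSS subn0 => e1 e2.
have e3 : (Z ^ 2 + p * m ^ 2 + p.+1 ^ 3 = p.+1 ^ 4 + p.+1 ^ 7)%N.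
  by rewrite e2 mulnBl mul1n -expnD -addnA subnK // leq_exp2l // ltnS.
have e1' : (Z%:Z + p%:Z * m%:Z = (p%:Z + 1) ^+ 4) by lia.
have e3' : (Z%:Z ^+ 2 + p%:Z * m%:Z ^+ 2 + (p%:Z + 1) ^+ 3 = (p%:Z + 1) ^+ 4 + (p%:Z + 1) ^+ 7).
  by lia.
have eZ : Z%:Z = (p%:Z + 1) ^+ 4 - p%:Z * m%:Z by rewrite -e1' addrK.
have : p%:Z * ((p%:Z + 1) * ((m%:Z - (p%:Z + 1) ^+ 3 - (p%:Z + 1)) *
         (m%:Z - (p%:Z + 1) ^+ 3 + (p%:Z + 1)))) = 0.
  by move/eqP: e3'; rewrite eZ -subr_eq0 => /eqP <-; ring.
move/eqP; rewrite !mulf_eq0 => /or3P [|| /orP []] /eqP e4; [lia | lia | right | left].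
  have em : m%:Z = (p%:Z + 1) ^+ 3 + (p%:Z + 1) by lia.
  by rewrite em in eZ; lia.
have em : m%:Z = (p%:Z + 1) ^+ 3 - (p%:Z + 1) by lia.
by rewrite em in eZ; lia.
Qed.

End Form.

Arguments form_fiber (a b c t)%_R.

(** * Affine points and common lines: the nondegenerate case *)

Section Counts.
Variables a b c d e f : F.

(* The common lines through P in its tangent plane. *)
Definition kcount : nat := \count_m ((N m == 1) && (a + c * m + b * m ^+ 2 == 0)).

(* The common points outside the tangent plane at P. *)
Definition ncount : nat := (\sum_x \count_y
  (Tr (f + d * x + e * y + a * x ^+ 2 + c * x * y + b * y ^+ 2) + N x + N y == 0))%N.

Lemma kcount_le2 : [|| a != 0, b != 0 | c != 0] -> (kcount <= 2)%N.
Proof.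
move=> abc; pose p : {poly F} := Poly [:: a; c; b].
have p0 : p != 0.
  apply/negP => /eqP p0; have := coef_Poly [:: a; c; b]; rewrite -/p p0 => co.
  by move: abc (co 0%N) (co 1%N) (co 2%N); rewrite !coef0 /= => /or3P [] /eqP h1 h2 h3 h4;
    apply: h1.
apply: leq_trans (@count_roots_le F p _ p0 (size_Poly _)).
apply: leq_sum => m _; rewrite rootE horner_Poly /=.
have -> : ((0 * m + b) * m + c) * m + a = a + c * m + b * m ^+ 2 by ring.
by case: (N m == 1).
Qed.

(** The equation becomes a = b m^2, which has at most one root because squaring is injective. *)
Lemma kcount_le1 : c = 0 -> (a != 0) || (b != 0) -> (kcount <= 1)%N.
Proof.
move=> c0 ab; rewrite /kcount c0; apply: count_le1 => m m' /andP [_ h1] /andP [_ h2].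
move: h1 h2; rewrite !mul0r !addr0 !addr_eq0_char2 => /eqP h1 /eqP h2.
have b0 : b != 0.
  by apply: contraTN ab => /eqP b0; rewrite h1 b0 mul0r eqxx.
by apply: sqr_inj; apply: (mulfI b0); rewrite -h1 -h2.
Qed.

Lemma kcount_gt0 : (0 < kcount)%N -> exists m, N m = 1 /\ a + c * m + b * m ^+ 2 = 0.
Proof.
case: (pickP (fun m => (N m == 1) && (a + c * m + b * m ^+ 2 == 0))) =>
  [m /andP [/eqP h1 /eqP h2] _|n0]; first by exists m.
by rewrite /kcount big1 // => m _; rewrite n0.
Qed.

Lemma polar_inj : N c != 1 -> injective (fun w => (polar1 c w, polar2 c w)).
Proof.
move=> Nc v w [h1 h2]; have [|/(polar_neq0 Nc)] := eqVneq (v + w) 0.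
  by case: v w {h1 h2} => [x y] [x' y'] [/eq_char2 -> /eq_char2 ->].
have -> : polar1 c (v + w) = 0 by rewrite -[RHS](addxx (polar1 c v)) {2}h1 /polar1 /= cjD; ring.
have -> : polar2 c (v + w) = 0 by rewrite -[RHS](addxx (polar2 c v)) {2}h2 /polar2 /= cjD; ring.
by rewrite eqxx.
Qed.

(** The polar map is injective on a finite set, hence onto, so some w has polar components (d, e).
    Translation by w absorbs the linear terms. *)
Lemma ncount_form_fiber : N c != 1 -> exists2 t, cj t = t & ncount = form_fiber a b c t.
Proof.
move=> Nc; have [g _ gK] := injF_bij (polar_inj Nc).
have [h1 h2] := gK (d, e); set w := g (d, e) in h1 h2.
exists (affine_form a b c w + Tr f); first by rewrite cjD cj_affine_form cjTr.
rewrite /ncount pair_big /form_fiber [RHS](reindex_inj (addIr w)); apply: eq_bigr => -[x y] _ /=.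
rewrite affine_formD h1 h2 /= -[_ == _ + Tr f]addr_eq0_char2; congr (nat_of_bool (_ == _)).
by rewrite /affine_form /Tr /N /= !cjE; char2.
Qed.

(* In the coordinates [x] and [z = y + m x] the form is affine in [x]. *)
Lemma form_fiber0_isotropic m : N c != 1 -> N m = 1 -> a + c * m + b * m ^+ 2 = 0 ->
  (form_fiber a b c 0 + q = q ^ 3 + q ^ 2)%N.
Proof.
move=> Nc Nm hm.
have -> : form_fiber a b c 0 = (\sum_z \count_x (Tr ((c * z +
  m * cj z) * x) == affine_form a b c (0%R, z)))%N.
  rewrite exchange_big /form_fiber -(pair_big xpredT xpredT
    (fun x y => nat_of_bool (affine_form a b c (x, y) == 0))) /=.
  apply: eq_bigr => x _; rewrite (reindex_inj (addrI (m * x))); apply: eq_bigr => z _.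
  rewrite -[_ == affine_form _ _ _ _ in RHS]addr_eq0_char2; congr (nat_of_bool (_ == _)).
  have e1 : a = c * m + b * m ^+ 2 by apply: eq_char2; rewrite addrA.
  have : cj m * m = 1 by rewrite mulrC.
  rewrite e1 /affine_form /Tr /N /= !cjE => e2; char2_with e2.
transitivity (q ^ 2 + (q ^ 2 - 1) * q + q)%N; last first.
  have := q_gt1; case: (q) => // p; nia.
rewrite (bigD1 (0 : F)) //=; congr (_ + _ + _)%N.
  rewrite -hF -sum1_card; apply: eq_bigr => x _.
  by rewrite /affine_form /= !(mulr0, mul0r, addr0, cj0, Tr0, N0, expr0n) eqxx.
rewrite (eq_bigr (fun => q)) => [|z z0].
  by rewrite sum_nat_const cardC1 hF subn1.
apply: count_Tr_mul; last exact: cj_affine_form.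
(* If the coefficient of x vanished, comparing norms in c z = m z^q would give N(c) = 1. *)
apply: contra Nc; rewrite addr_eq0_char2 => /eqP /(congr1 N); rewrite !NM Nm mul1r N_cj => /eqP.
by rewrite -{2}[N z]mul1r (inj_eq (mulIf _)) // N_eq0.
Qed.

(** A common line through P forces the hyperbolic type by [form_fiber0_isotropic]; the elliptic type
    survives only when [kcount] is 0. *)
Lemma ncount_nondegenerate : N c != 1 ->
  ((ncount + q = q ^ 3 + q ^ 2 \/ ncount + q = q ^ 3) \/
   (kcount = 0 /\ (ncount + q ^ 2 = q ^ 3 + q \/ ncount = q ^ 3 + q)))%N.
Proof.
move=> Nc; have [t /(form_fiber_cases a b c) ht ->] := ncount_form_fiber Nc.
have [k0|/kcount_gt0 [m [m1 m2]]] := posnP kcount.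
  by case: (form_fiber_sizes a b Nc) ht => -[h1 h2] []->; tauto.
have q1 := q_gt1; have Z := form_fiber0_isotropic Nc m1 m2.
left; case: (form_fiber_sizes a b Nc) ht => -[h1 h2] []->; try tauto; nia.
Qed.

(** * The degenerate case N(c) = 1 *)

Section Degenerate.
Hypothesis Nc : N c = 1.

Definition rho := a + c ^+ 2 * cj b.
Definition delta := d + c * cj e.
Definition alpha (X : F) : F := Tr (b * X ^+ 2 + e * X + f) + N X.

Lemma cj_alpha X : cj (alpha X) = alpha X.
Proof. by rewrite /alpha cjD cjTr cjN. Qed.

(* [X = y + cj (c * x)] diagonalizes the form because [N c = 1]. *)
Lemma ncount_split :
  (ncount = \sum_X \count_x (alpha X + Tr (rho * x ^+ 2 + delta * x) == 0))%N.
Proof.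
rewrite exchange_big; apply: eq_bigr => x _.
rewrite (reindex_inj (addIr (cj (c * x)))); apply: eq_bigr => X _.
congr (nat_of_bool (_ == _)); have : c * cj c = 1 by [].
rewrite /alpha /rho /delta /Tr /N !cjE => e1; char2_with e1.
Qed.

(* Averaging over the translations of [z] by elements of GF(q), which [Tr] does not see. *)
Lemma count_form_nonFq d' t : cj d' != d' -> cj t = t ->
  (\count_z (Tr z ^+ 2 + Tr (d' * z) == t) = q)%N.
Proof.
move=> hd ht; have q0 : (0 < q)%N by apply: ltnW q_gt1.
apply/eqP; rewrite -(eqn_pmul2l q0) mulnn -hF; apply/eqP.
have w0 : Tr d' != 0 by rewrite /Tr addr_eq0_char2 eq_sym.
pose psi z := Tr z ^+ 2 + Tr (d' * z).
transitivity (\sum_(u | (cj u == u)%R) \count_z (psi (z + u) == t))%N.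
  rewrite -[in LHS]count_Fq big_distrl [RHS]big_mkcond; apply: eq_bigr => u _ /=.
  case: ifP => hu; last by rewrite mul0n.
  by rewrite mul1n (reindex_inj (addIr u)).
rewrite exchange_big -sum1_card; apply: eq_bigr => z _ /=.
have cj_psi : cj (psi z) = psi z by rewrite /psi cjD cjX !cjTr.
(* For u in GF(q), [psi (z + u)] is affine in u with nonzero slope [Tr d'], so exactly one u reaches
   t. *)
rewrite -[RHS](sum_pred1 ((t + psi z) / Tr d')) [LHS]big_mkcond; apply: eq_bigr => u _.
have e1 : cj u = u -> psi (z + u) = psi z + u * Tr d'.
  by move=> hu; rewrite /psi /Tr !cjE hu; char2.
case: eqP => hu.
  rewrite (e1 hu) eq_sym -addr_eq0_char2 addrA addr_eq0_char2.
  by rewrite -[_ / _ == u](inj_eq (mulIf w0)) mulfVK // [in LHS]eq_sym.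
case: eqP => // e2; case: hu; rewrite -e2 cjM cjV cjD ht cj_psi cjTr //.
Qed.

(** Only T = Tr z matters, each T in GF(q) arising from q values of z. The equation becomes N(X +
    eps^q) = s(T), with one solution X if s(T) = 0 and q + 1 otherwise; r is the number of roots of
    s in GF(q). *)
Lemma count_form_Fq d' beta : cj d' = d' -> b = beta ^+ 2 ->
  exists2 r, (r <= 2)%N &
  (\sum_X \count_z (alpha X + (Tr z ^+ 2 + Tr (d' * z)) == 0) + q ^ 2 * r = q ^ 3 + q ^ 2)%N.
Proof.
move=> hd hb; pose eps := e + d' * beta; pose s T := T ^+ 2 + d' * T + (Tr f + N eps).
exists (\sum_(T | (cj T == T)%R) (s T == 0)%R)%N.
  apply: leq_trans (count_quad_le d' (Tr f + N eps)); rewrite big_mkcond.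
  by apply: leq_sum => T _; rewrite /s addr_eq0_char2; case: (_ == T).
have -> : (\sum_X \count_z (alpha X + (Tr z ^+ 2 + Tr (d' * z)) == 0) =
           q * \sum_(T | (cj T == T)%R) \count_X (N (X + cj eps) == s T))%N.
  rewrite (eq_bigr (fun X => q * \sum_(T | (cj T == T)%R) (N (X + cj eps) == s T)%R))%N => [|X _].
    by rewrite -big_distrr exchange_big.
  rewrite (eq_bigr (fun z => nat_of_bool (alpha X + (Tr z ^+ 2 + d' * Tr z) == 0))) => [|z _];
    last first.
    by congr (nat_of_bool (_ == _)); rewrite /Tr !cjE hd; ring.
  rewrite (sum_Tr (fun T => nat_of_bool (alpha X + (T ^+ 2 + d' * T) == 0))); congr muln.
  (* Since Tr(beta X)^2 = Tr(b X^2), this shift cancels the trace of the quadratic term of [alpha];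
     the term d' Tr(beta X) it creates turns e into [eps]. *)
  rewrite (reindex_inj (addIr (Tr (beta * X)))) /=.
  apply: eq_big => [T|T _]; first by rewrite cjD cjTr (inj_eq (addIr _)).
  rewrite -[_ == s T]addr_eq0_char2; congr (nat_of_bool (_ == _)).
  by rewrite /alpha /s /eps hb /Tr /N !cjE hd; char2.
set S := (\sum_(T | _) _)%N; set r := (\sum_(T | _) _)%N.
suff: (S + q * r = q.+1 * q)%N by nia.
rewrite /S /r big_distrr -big_split /= -[X in (_ * X)%N]count_Fq -sum_cond_const.
apply: eq_bigr => T /eqP hT;
  have hs : cj (s T) = s T by rewrite /s cjD (cjD (Tr f)) cjTr cjN !cjE hT hd.
have -> : (\count_X (N (X + cj eps) == s T) = \count_X (N X == s T))%N.
  by rewrite [RHS](reindex_inj (addIr (cj eps))).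
have [->|sT0] := eqVneq (s T) 0; first by rewrite count_N0 muln1.
by rewrite count_N // muln0 addn0.
Qed.

(** Scaling x by a square root of [rho] turns Tr(rho x^2) into (Tr z)^2; the count then depends on
    whether the new linear coefficient d' lies in GF(q). *)
Lemma ncount_rho : rho != 0 ->
  (kcount <= 1 /\ exists2 r, r <= 2 & ncount + q ^ 2 * r = q ^ 3 + q ^ 2)%N.
Proof.
move=> rho0; split.
  (* Two roots of norm 1 would give [a = b m m'] and [c = b (m + m')], hence [rho = 0]. *)
  apply: count_le1 => m m' /andP [/eqP Nm /eqP h1] /andP [/eqP Nm' /eqP h2].
  apply/eqP; apply: contraTT rho0 => mm'; rewrite negbK.
  have c0 : c != 0 by rewrite -N_eq0 Nc oner_eq0.
  have [m0 m'0] : m != 0 /\ m' != 0 by split; rewrite -N_eq0 ?Nm ?Nm' oner_eq0.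
  have e1 : c = b * (m + m').
    have : (m + m') * (c + b * (m + m')) = 0.
      by apply: etrans (_ : (a + c * m + b * m ^+ 2) + (a + c * m' + b * m' ^+ 2) = _);
        [char2 | rewrite h1 h2 addr0].
    by move/eqP; rewrite mulf_eq0 !addr_eq0_char2 (negPf mm') => /eqP.
  have e2 : a = b * m * m'.
    by apply: eq_char2; rewrite -[RHS]h1 e1; char2.
  have e3 : cj c * m * m' = cj b * (m + m').
    rewrite e1 !cjE; move: Nm Nm'; rewrite /N => n1 n2.
    by rewrite -[m in RHS]mulr1 -[m' in RHS]mulr1 -{1}n2 -n1; ring.
  have e4 : m * m' = c * cj b * (m + m').
    by rewrite -[LHS]mul1r -Nc /N -mulrA -mulrA [_ * (m * m')]mulrA e3; ring.
  have e5 : c ^+ 2 * cj b = c * (b * (m + m')) * cj b by rewrite -e1 expr2.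
  by rewrite /rho addr_eq0_char2 e2 -mulrA e4 e5; apply/eqP; ring.
have [r rE] := exists_sqrt rho; have [beta betaE] := exists_sqrt b.
have r0 : r != 0 by rewrite -sqrf_eq0 rE.
pose d' := delta / r.
have nE : (ncount = \sum_X \count_z (alpha X + (Tr z ^+ 2 + Tr (d' * z)) == 0))%N.
  rewrite ncount_split; apply: eq_bigr => X _.
  rewrite [RHS](reindex_inj (mulfI r0)); apply: eq_bigr => x _.
  congr (nat_of_bool (_ == _)); have -> : delta = d' * r by rewrite mulfVK.
  by rewrite -rE /Tr !cjE; char2.
have [hd|/eqP hd] := cj d' =P d'.
  by rewrite nE; apply: count_form_Fq hd (esym betaE).
(* Here every X admits q values of z, so the count is q^3, which corresponds to r = 1. *)
exists 1%N => //; rewrite muln1; congr addn.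
rewrite nE (eq_bigr (fun => q)) => [|X _]; first by rewrite sum_nat_const hF -expnSr.
rewrite -[RHS](count_form_nonFq hd (cj_alpha X)); apply: eq_bigr => z _.
by rewrite addr_eq0_char2 eq_sym.
Qed.

(** Now a = c^2 b^q, so at (b / c, z) the form equals b (N(b) + z^2 + z), which vanishes for an
    Artin-Schreier root z of N(b). This excludes [rho = 0] for elliptic quadrics. *)
Lemma rho0_isotropic : rho = 0 ->
  exists x y, (x, y) != 0 /\ a * x ^+ 2 + c * x * y + b * y ^+ 2 = 0.
Proof.
move=> /eqP; rewrite /rho addr_eq0_char2 => /eqP ha.
have c0 : c != 0 by rewrite -N_eq0 Nc oner_eq0.
have [b0|b0] := eqVneq b 0.
  exists 1, 0; split; first by apply/eqP => -[/eqP]; rewrite oner_eq0.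
  by rewrite ha b0 cj0; ring.
have [z hz] := artin_schreier_root (cjN b).
exists (b / c), z; split; first by apply/eqP => -[/eqP];
  rewrite mulf_eq0 invr_eq0 (negPf b0) (negPf c0).
have -> : a * (b / c) ^+ 2 + c * (b / c) * z + b * z ^+ 2 = b * (N b + (z ^+ 2 + z)).
  by rewrite ha /N; field.
by rewrite hz addxx mulr0.
Qed.

(** The part of the form in X alone: for [rho = 0], the binary GF(q)-form induced on the quotient by
    the radical. *)
Definition radical_form (X : F) : F := Tr (b * X ^+ 2) + N X.

Lemma cj_radical_form X : cj (radical_form X) = radical_form X.
Proof. by rewrite /radical_form cjD cjTr cjN. Qed.

Lemma radical_formZ l X : cj l = l -> radical_form (l * X) = l ^+ 2 * radical_form X.
Proof. by move=> hl; rewrite /radical_form /Tr /N !cjE hl; ring. Qed.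

Let kradical : nat := \count_m ((N m == 1) && (cj b + m + b * m ^+ 2 == 0)).

(** Replacing m by c m preserves norm 1 and factors c^2 out of the polynomial. *)
Lemma kcount_rho0 : rho = 0 -> kcount = kradical.
Proof.
move=> /eqP; rewrite /rho addr_eq0_char2 => /eqP ha.
have c0 : c != 0 by rewrite -N_eq0 Nc oner_eq0.
rewrite /kcount (reindex_inj (mulfI c0)); apply: eq_bigr => m _.
rewrite NM Nc mul1r; congr (nat_of_bool (_ && _)).
have -> : a + c * (c * m) + b * (c * m) ^+ 2 = c ^+ 2 * (cj b + m + b * m ^+ 2) by rewrite ha; ring.
by rewrite mulf_eq0 sqrf_eq0 (negPf c0).
Qed.

(** For nonzero X, m = X / X^q has norm 1 and the form equals X^(2q) (b^q + m + b m^2). By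
    [count_twist], each m of norm 1 arises from q - 1 values of X. *)
Lemma radical_form_zeros : (\count_X (radical_form X == 0) = 1 + kradical * (q - 1))%N.
Proof.
rewrite (bigD1 (0 : F)) //=; congr addn.
  by rewrite /radical_form expr0n mulr0 Tr0 N0 addr0 eqxx.
transitivity (\sum_(X : F) [&& X != 0 & radical_form X == 0]%R)%N.
  by rewrite big_mkcond; apply: eq_bigr => X _; case: (X == 0).
rewrite -(sum_fibers (fun X => X / cj X)) /kradical big_distrl; apply: eq_bigr => m _ /=.
have [m1|m1] := eqVneq (N m) 1; last first.
  apply: big1 => X _; case: (X =P 0) => //= X0; case: (_ / _ =P m) => [e1|]; rewrite ?andbF //.
  case/eqP: m1; rewrite -e1 NM /N cjV cjK; field.
  by rewrite cj_eq0 andbb; apply/eqP.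
have m0 : m != 0 by rewrite -N_eq0 m1 oner_eq0.
have e1 X : X != 0 -> (X / cj X == m) = (X + m * cj X == 0).
  by move=> X0;
    rewrite addr_eq0_char2 -[RHS](inj_eq (mulIf (_ : (cj X)^-1 != 0))) ?invr_eq0 ?cj_eq0 // mulfK // cj_eq0.
transitivity (\sum_(X | (X != 0)%R) (X + m * cj X == 0)%R *
  (cj b + m + b * m ^+ 2 == 0)%R)%N.
  rewrite [RHS]big_mkcond; apply: eq_bigr => X _; have [//|X0] := eqVneq X 0.
  rewrite (e1 _ X0) /=; case: (X + m * cj X =P 0) => [h1|]; rewrite ?andbF // andbT mul1n.
  have h2 : X = m * cj X by apply: eq_char2.
  have -> : radical_form X = cj X ^+ 2 * (cj b + m + b * m ^+ 2).
    by rewrite /radical_form /Tr /N !cjE {1 3}h2; ring.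
  by rewrite mulf_eq0 sqrf_eq0 cj_eq0 (negPf X0).
rewrite -big_distrl mulnC; congr muln.
by rewrite -(count_twist m1) [in RHS](bigD1 (0 : F)) //= cj0 mulr0 addr0 eqxx addKn.
Qed.

(* If [m] is a root of norm 1, then so is [m + b^-1]. *)
Lemma kcount_radical_cases : kradical = 0%N \/ kradical = 2%N.
Proof.
have [->|k0_gt0] := posnP kradical; first by left.
right; apply/eqP; rewrite eqn_leq; apply/andP; split.
  have [b0|b0] := eqVneq b 0.
    apply: (@leq_trans 1) => //; apply: count_le1 => m m' /andP [_ h1] /andP [_ h2].
    by move: h1 h2; rewrite b0 cj0 !add0r !mul0r !addr0 => /eqP -> /eqP ->.
  apply: leq_trans (count_quad_le b^-1 (cj b / b)); apply: leq_sum => m _.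
  case: (N m == 1) => //=.
  have -> : cj b + m + b * m ^+ 2 = b * (m ^+ 2 + b^-1 * m + cj b / b) by field.
  by rewrite mulf_eq0 (negPf b0) addr_eq0_char2.
case: (pickP (fun m => (N m == 1) && (cj b + m + b * m ^+ 2 == 0))) => [m /andP [m1 m2]|n0];
  last by move: k0_gt0; rewrite /kradical big1 // => m _; rewrite n0.
have b0 : b != 0.
  apply: contraTneq m1 => b0; move: m2; rewrite b0 cj0 add0r mul0r addr0 => /eqP ->.
  by rewrite N0 eq_sym oner_eq0.
have cb0 : cj b != 0 by rewrite cj_eq0.
have mb0 : m + b^-1 != m.
  by rewrite -[X in _ != X]addr0 (inj_eq (addrI _)) invr_eq0.
have P2 : (N (m + b^-1) == 1) && (cj b + (m + b^-1) + b * (m + b^-1) ^+ 2 == 0).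
  have m0 : m != 0 by rewrite -N_eq0 (eqP m1) oner_eq0.
  have h3 : cj m * m = 1 by rewrite mulrC; apply/eqP.
  apply/andP; split; last first.
    rewrite -(eqP m2); apply/eqP; apply: (mulfI b0).
    rewrite !mulrDr mulfV // [b * (b * (m + b^-1) ^+ 2)]mulrA -!expr2 -exprMn mulrDr mulfV //;
      char2.
  (* Dividing the equation by m, where m^-1 = m^q, shows that b m has trace 1; hence m + b^-1 has
     norm 1. *)
  have h4 : cj b * cj m + b * m = 1.
    apply: (mulIf m0); have -> : (cj b * cj m + b * m) * m = cj b * (cj m * m) + b * m ^+ 2 by ring.
    rewrite h3 mulr1 mul1r; apply: eq_char2; rewrite -[RHS](eqP m2); ring.
  apply/eqP; apply: (mulfI b0); apply: (mulfI cb0).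
  rewrite /N cjD cjV.
  have -> : cj b * (b * ((m + b^-1) * (cj m + (cj b)^-1))) = (b * m + 1) * (cj b * cj m + 1).
    by field; rewrite b0 cb0.
  have -> : (b * m + 1) * (cj b * cj m + 1) =
    cj b * (b * (cj m * m)) + ((cj b * cj m + b * m) + 1) by ring.
  by rewrite h3 h4 addxx addr0.
rewrite /kradical (bigD1 m) //= m1 m2 (bigD1 (m + b^-1)) /=; last by rewrite mb0.
by rewrite P2.
Qed.

(** If [delta] is nonzero, each X leaves a trace equation with q solutions x. Otherwise x is free,
    and translating X by e^q leaves [radical_form X = t]; the last two alternatives are t = 0 and t
    nonzero. *)
Lemma ncount_rho0 : rho = 0 ->
  (kcount = 0 \/ kcount = 2)%N /\
  [\/ ncount = q ^ 3, ncount = q ^ 2 * (1 + kcount * (q - 1))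
    | ncount + q ^ 2 * kcount = q ^ 2 * q.+1]%N.
Proof.
move=> r0; rewrite (kcount_rho0 r0); split; first exact: kcount_radical_cases.
rewrite ncount_split r0.
have [d0|d0] := eqVneq delta 0; last first.
  constructor 1; rewrite (eq_bigr (fun => q)) => [|X _]; first by rewrite sum_nat_const hF -expnSr.
  rewrite -[RHS](count_Tr_mul d0 (cj_alpha X)); apply: eq_bigr => x _.
  by rewrite mul0r add0r addr_eq0_char2 eq_sym.
pose t := Tr (b * cj e ^+ 2 + f) + N e.
have ht : cj t = t by rewrite /t cjD cjTr cjN.
have -> : (\sum_X \count_x (alpha X + Tr (0 * x ^+ 2 + delta * x) == 0) =
  q ^ 2 * (\count_X (radical_form X == t)))%N.
  rewrite (reindex_inj (addIr (cj e))) big_distrr; apply: eq_bigr => X _ /=.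
  rewrite (eq_bigr (fun => nat_of_bool (radical_form X == t))) ?sum_nat_const ?hF // => x _.
  rewrite -[_ == t]addr_eq0_char2; congr (nat_of_bool (_ == _)).
  by rewrite d0 /alpha /radical_form /t /Tr /N !cjE; char2.
have lin (l : F) : l != 0 -> injective (fun X : F => l * X) by move=> l0; apply: mulfI.
have [->|t0] := eqVneq t 0; first by constructor 2; rewrite radical_form_zeros.
constructor 3; rewrite (fiber_scale lin radical_formZ ht t0) -mulnDr; congr muln.
have := fiber_sum cj_radical_form lin radical_formZ; rewrite radical_form_zeros hF.
by have := q_gt1; case: (q) => // p; nia.
Qed.

End Degenerate.

(** * From affine counts to vectors on both surfaces *)

(** For nonzero x, writing y = x m factors N(x) and x^2 out of the equations and leaves those of
    [kcount]. *)
Lemma count_infinity :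
  (\sum_x \count_y ((N x + N y == 0) && (a * x ^+ 2 + c * x * y + b * y ^+ 2 == 0))
  = 1 + kcount * (q ^ 2 - 1))%N.
Proof.
rewrite (bigD1 (0 : F)) //=; congr addn.
  rewrite -(sum_pred1 (0 : F)); apply: eq_bigr => y _.
  rewrite N0 add0r N_eq0 eq_sym; case: eqP => // <-.
  by rewrite expr0n /= !(mulr0, addr0) eqxx.
rewrite (eq_bigr (fun=> kcount)) => [|x x0].
  by rewrite sum_nat_const cardC1 hF subn1 mulnC.
rewrite (reindex_inj (mulfI x0)); apply: eq_bigr => m _.
have -> : N x + N (x * m) = N x * (N m + 1) by rewrite NM; ring.
have -> : a * x ^+ 2 + c * x * (x * m) + b * (x * m) ^+ 2 =
  x ^+ 2 * (a + c * m + b * m ^+ 2) by ring.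
by rewrite (mulf_eq0 (N x)) (mulf_eq0 (x ^+ 2)) N_eq0 sqrf_eq0 (negPf x0) /= (addr_eq0_char2 (N m)).
Qed.

Lemma count_normal_form :
  (\sum_s \sum_t \sum_x \count_y ((Tr (t * cj s) + N x + N y == 0) &&
     (t * s + f * s ^+ 2 + s * (d * x + e * y) + (a * x ^+ 2 + c * x * y + b * y ^+ 2) == 0))
  = 1 + (ncount + 1 + q ^ 2 * kcount) * (q ^ 2 - 1))%N.
Proof.
rewrite (bigD1 (0 : F)) //=.
have -> : (1 + (ncount + 1 + q ^ 2 * kcount) * (q ^ 2 - 1) =
  q ^ 2 * (1 + kcount * (q ^ 2 - 1)) + (q ^ 2 - 1) * ncount)%N.
  have : (0 < q ^ 2)%N by rewrite expn_gt0 ltnW ?q_gt1.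
  case: (q ^ 2)%N => // p _; rewrite subSS subn0; ring.
congr addn.
  rewrite -count_infinity -hF -sum_nat_const; apply: eq_bigr => t _.
  apply: eq_bigr => x _; apply: eq_bigr => y _.
  by rewrite cj0 expr0n !(mulr0, mul0r, Tr0, add0r).
have -> : (q ^ 2 - 1 = #|predC1 (0 : F)%R|)%N by rewrite cardC1 hF subn1.
rewrite -sum_nat_const; apply: eq_bigr => s s0.
rewrite /ncount exchange_big (reindex_inj (mulfI s0)); apply: eq_bigr => x _.
rewrite exchange_big (reindex_inj (mulfI s0)); apply: eq_bigr => y _ /=.
rewrite (reindex_inj (mulfI s0)) /=;
  set r := f + d * x + e * y + a * x ^+ 2 + c * x * y + b * y ^+ 2.
have Ns : N s != 0 by rewrite N_eq0.
(* After scaling t, x, y by s, the quadric forces t = r, and the Hermitian equation becomes that of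
   [ncount]. *)
transitivity (\count_t ((r == t) && (Tr r + N x + N y == 0)))%N; last first.
  rewrite (bigD1 r) //= eqxx /= big1 ?addn0 // => t; by rewrite eq_sym => /negPf->.
apply: eq_bigr => t _; congr nat_of_bool.
have -> : s * t * s + f * s ^+ 2 + s * (d * (s * x) + e * (s * y)) +
  (a * (s * x) ^+ 2 + c * (s * x) * (s * y) + b * (s * y) ^+ 2) = s ^+ 2 * (r + t) by rewrite /r;
    ring.
rewrite mulf_eq0 sqrf_eq0 (negPf s0) /= (addr_eq0_char2 r) andbC; case: (r =P t) => //= <-.
have -> : Tr (s * r * cj s) + N (s * x) + N (s * y) = N s * (Tr r + N x + N y).
  by rewrite !NM /Tr /N !cjE; ring.
by rewrite mulf_eq0 (negPf Ns).
Qed.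

End Counts.

(** * Hermitian forms and adapted frames *)

Section HermitianForm.
Variable H : 'M[F]_4.
Hypothesis hH : nondeg_hermitian q H.

Definition herm (x y : 'rV[F]_4) : F := \sum_i \sum_j H i j * x 0 i * cj (y 0 j).

Lemma hermE x : herm x x = hform q H x. Proof. by []. Qed.

Lemma hermDl x y z : herm (x + y) z = herm x z + herm y z.
Proof.
rewrite -big_split; apply: eq_bigr => i _; rewrite -big_split; apply: eq_bigr => j _.
by rewrite mxE /=; ring.
Qed.

Lemma hermZl l x z : herm (l *: x) z = l * herm x z.
Proof.
rewrite big_distrr; apply: eq_bigr => i _; rewrite big_distrr; apply: eq_bigr => j _.
by rewrite mxE /=; ring.
Qed.

Lemma hermC x y : herm y x = cj (herm x y).
Proof.
rewrite /herm (big_morph cj cjD cj0) exchange_big; apply: eq_bigr => i _.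
rewrite (big_morph cj cjD cj0); apply: eq_bigr => j _.
by rewrite !cjE (hH.1 i j) -/(cj _) ; ring.
Qed.

Lemma hermDr x y z : herm z (x + y) = herm z x + herm z y.
Proof. by rewrite hermC hermDl cjD -!hermC. Qed.

Lemma hermZr l x z : herm z (l *: x) = cj l * herm z x.
Proof. by rewrite hermC hermZl cjM -hermC. Qed.

Lemma herm_nondegenerate y : (forall x, herm x y = 0) -> y = 0.
Proof.
move=> hy; pose z : 'cV[F]_4 := \col_j cj (y 0 j).
have uH : H \in unitmx by rewrite unitmxE unitfE hH.2.
have z0 : z = 0.
  rewrite -(mulKmx uH z); have -> : H *m z = 0; last by rewrite mulmx0.
  apply/matrixP => i k; rewrite !mxE; apply: etrans (hy (delta_mx 0 i));
    rewrite /herm [RHS](bigD1 i) //= [X in _ + X]big1 ?addr0.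
    by apply: eq_bigr => j _; rewrite !mxE !eqxx mulr1.
  by move=> l li; apply: big1 => j _; rewrite mxE (negPf li) andbF mulr0 mul0r.
apply/matrixP => i j; rewrite ord1 mxE; apply/eqP; rewrite -cj_eq0.
by have /matrixP/(_ j 0) := z0; rewrite !mxE => ->.
Qed.

(** If [herm x y] were nonzero, some l would give the cross terms of x + l y the sum 1, making this
    vector of [W] anisotropic. *)
Lemma herm_totally_isotropic (W : pred 'rV[F]_4) :
  (forall x y l, W x -> W y -> W (x + l *: y)) -> (forall x, W x -> herm x x = 0) ->
  forall x y, W x -> W y -> herm x y = 0.
Proof.
move=> Wl W0 x y Wx Wy; apply/eqP; apply/negPn/negP => xy0.
have [l hl] : exists l, Tr (l * herm y x) = 1.
  have yx0 : herm y x != 0 by rewrite hermC cj_eq0.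
  case: (pickP (fun l => Tr (herm y x * l) == 1)) => [l /eqP <-|n0]; first by exists l;
    rewrite mulrC.
  have := count_Tr_mul yx0 cj1; rewrite big1 => [e1|l _]; last by rewrite n0.
  by have := q_gt1; rewrite -e1.
have := W0 _ (Wl _ _ l Wx Wy);
  rewrite hermDl !hermDr !hermZl !hermZr (W0 _ Wx) (W0 _ Wy) !mulr0 addr0 add0r.
rewrite (hermC y x) -cjM addrC -/(Tr _) hl => /eqP; by rewrite oner_eq0.
Qed.

(** [W] is the orthogonal complement of the span parametrized by [sp]. If it were totally isotropic
    it would be orthogonal to the whole space, hence zero, and [sp] would be onto, against the
    cardinalities. Surjectivity of the norm onto GF(q) then normalizes an anisotropic vector. *)
Lemma exists_unit_vector (T : finType) (sp : T -> 'rV[F]_4) (W : pred 'rV[F]_4) :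
  (#|T| < #|{: 'rV[F]_4}|)%N ->
  (forall x y l, W x -> W y -> W (x + l *: y)) ->
  (forall y, exists t, W (y - sp t)) ->
  (forall w t, W w -> herm (sp t) w = 0) ->
  exists2 u, W u & herm u u = 1.
Proof.
move=> cT Wl Wsp Wo.
have [u Wu u0] : exists2 u, W u & herm u u != 0.
  have [u /andP [Wu u0]|nex] := pickP (fun u => W u && (herm u u != 0)); first by exists u.
  exfalso; move: cT; apply/negP; rewrite -leqNgt.
  have W0 x : W x -> herm x x = 0.
    by move=> Wx; move: (nex x); rewrite Wx => /negbFE /eqP.
  have Wz x : W x -> x = 0.
    move=> Wx; apply: herm_nondegenerate => y; have [t Wy] := Wsp y.
    by rewrite -(subrK (sp t) y) hermDl (Wo x t Wx) (herm_totally_isotropic Wl W0 Wy Wx) addr0.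
  have sp_surj : {subset predT <= codom sp}.
    move=> y _; have [t /Wz /eqP] := Wsp y; rewrite subr_eq0 => /eqP ->; exact: codom_f.
  have := subset_leq_card (introT subsetP sp_surj).
  by move/leq_trans; apply; apply: leq_image_card.
have hu : cj (herm u u) = herm u u by rewrite -hermC.
have [l hl] : exists l, N l = (herm u u)^-1.
  case: (pickP (fun l => N l == (herm u u)^-1)) => [l /eqP <-|n0]; first by exists l.
  have := @count_N (herm u u)^-1; rewrite cjV hu invr_eq0 big1 => [e1|l _]; last by rewrite n0.
  by have := e1 erefl u0.
exists (l *: u).
  rewrite -[l *: u]addr0.
  (* Closure of [W] is available only for x + l y, so l u is written in that shape. *)
  have -> : l *: u + 0 = u + (l - 1) *: u by rewrite addr0 -{2}[u]scale1r -scalerDl addrC subrK.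
  exact: Wl.
by rewrite hermZl hermZr mulrA -/(N l) hl mulVf.
Qed.

Lemma hermNl x z : herm (- x) z = - herm x z.
Proof. by rewrite -scaleN1r hermZl mulN1r. Qed.

Lemma card_rV4 : #|{: 'rV[F]_4}| = (q ^ 8)%N.
Proof. by rewrite card_mx hF -expnM. Qed.

(** A vector not orthogonal to P is scaled to pair to 1 with it; adding l P with Tr(l) = [herm e e]
    then makes it isotropic in characteristic 2. *)
Lemma exists_hyperbolic_pair P : P != 0 -> herm P P = 0 ->
  exists e, [/\ herm e P = 1, herm P e = 1 & herm e e = 0].
Proof.
move=> P0 PP.
have [x xP] : exists x, herm x P != 0.
  have [x xP|nex] := pickP (fun x => herm x P != 0); first by exists x.
  case/eqP: P0; apply: herm_nondegenerate => x; exact: (eqP (negbFE (nex x))).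
pose e := (herm x P)^-1 *: x.
have eP : herm e P = 1 by rewrite hermZl mulVf.
have [l hl] : exists l, Tr l = herm e e.
  have [l /eqP|n0] := pickP (fun l => Tr l == herm e e); first by exists l.
  have := @count_Tr (herm e e); rewrite -hermC big1 => [e1|l _]; last by rewrite n0.
  by have := q_gt1; rewrite -e1.
have eP' : herm (e + l *: P) P = 1 by rewrite hermDl hermZl PP mulr0 addr0.
exists (e + l *: P); split => //; first by rewrite hermC eP' cj1.
rewrite hermDr hermZr eP' mulr1 hermDl hermZl (hermC e P) eP cj1 mulr1 -hl /Tr -addrA
  -[l + cj l]/(Tr l).
exact: addxx.
Qed.

Definition frame P e u1 u2 :=
  [/\ [/\ herm P P = 0, herm P e = 1, herm P u1 = 0 & herm P u2 = 0],
      [/\ herm e P = 1, herm e e = 0, herm e u1 = 0 & herm e u2 = 0],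
      [/\ herm u1 P = 0, herm u1 e = 0, herm u1 u1 = 1 & herm u1 u2 = 0]
    & [/\ herm u2 P = 0, herm u2 e = 0, herm u2 u1 = 0 & herm u2 u2 = 1]].

Lemma exists_frame P : P != 0 -> herm P P = 0 -> exists e u1 u2, frame P e u1 u2.
Proof.
move=> P0 PP; have [e [eP Pe ee]] := exists_hyperbolic_pair P0 PP.
have q1 := q_gt1.
have [u1 /andP [/eqP Pu /eqP eu] uu] : exists2 u1,
  (herm P u1 == 0) && (herm e u1 == 0) & herm u1 u1 = 1.
  apply: (@exists_unit_vector _ (fun t : F * F => t.1 *: P + t.2 *: e)
    (fun u => (herm P u == 0) && (herm e u == 0))).
  - by rewrite card_rV4 card_prod hF -expnD ltn_exp2l.
  - move=> x y l /andP [/eqP h1 /eqP h2] /andP [/eqP h3 /eqP h4].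
    by rewrite !hermDr !hermZr h1 h2 h3 h4 !mulr0 addr0 eqxx.
  (* In a hyperbolic pair the coefficient along one vector is the pairing with the other. *)
  - move=> y; exists (herm y e, herm y P) => /=.
    rewrite !(hermC _ P) !(hermC _ e) !(hermDl, hermNl, hermZl) PP Pe eP ee.
    by rewrite !(mulr0, mulr1, addr0, add0r) !subrr cj0 eqxx.
  - move=> w [t s] /andP [/eqP h1 /eqP h2] /=.
    by rewrite !(hermDl, hermZl) h1 h2 !mulr0 addr0.
have uP : herm u1 P = 0 by rewrite hermC Pu cj0.
have ue : herm u1 e = 0 by rewrite hermC eu cj0.
have [u2 /and3P [/eqP Pu2 /eqP eu2 /eqP uu2] u22] : exists2 u2, [&& herm P u2 == 0,
  herm e u2 == 0 & herm u1 u2 == 0] & herm u2 u2 = 1.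
  apply: (@exists_unit_vector _ (fun t : F * F * F => t.1.1 *: P + t.1.2 *: e + t.2 *: u1)
    (fun u => [&& herm P u == 0, herm e u == 0 & herm u1 u == 0])).
  - by rewrite card_rV4 !card_prod hF -!expnD ltn_exp2l.
  - move=> x y l /and3P [/eqP h1 /eqP h2 /eqP h5] /and3P [/eqP h3 /eqP h4 /eqP h6].
    by rewrite !hermDr !hermZr h1 h2 h3 h4 h5 h6 !mulr0 addr0 eqxx.
  - move=> y; exists (herm y e, herm y P, herm y u1) => /=.
    rewrite !(hermC _ P) !(hermC _ e) !(hermC _ u1) !(hermDl, hermNl,
      hermZl) PP Pe eP ee Pu eu uP ue uu.
    by rewrite !(mulr0, mulr1, addr0, add0r) !subrr cj0 eqxx.
  - move=> w [[t s] x] /and3P [/eqP h1 /eqP h2 /eqP h3] /=.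
    by rewrite !(hermDl, hermZl) h1 h2 h3 !mulr0 !addr0.
exists e, u1, u2; split; split => //; by rewrite hermC ?Pu2 ?eu2 ?uu2 cj0.
Qed.

End HermitianForm.

Definition frame_comb (P e u1 u2 : 'rV[F]_4) (v : F * F * F * F) : 'rV[F]_4 :=
  v.1.1.1 *: P + v.1.1.2 *: e + v.1.2 *: u1 + v.2 *: u2.

Lemma frame_combD P e u1 u2 v w :
  frame_comb P e u1 u2 (v + w) = frame_comb P e u1 u2 v + frame_comb P e u1 u2 w.
Proof. by rewrite /frame_comb /= !scalerDl; apply/matrixP => i j; rewrite !mxE; ring. Qed.

Lemma frame_combZ P e u1 u2 l v :
  frame_comb P e u1 u2 (l * v.1.1.1, l * v.1.1.2, l * v.1.2, l * v.2) = l *: frame_comb P e u1 u2 v.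
Proof. by rewrite /frame_comb /= !scalerDr !scalerA. Qed.

Section Frame.
Variables (H : 'M[F]_4) (P e u1 u2 : 'rV[F]_4).
Hypotheses (hH : nondeg_hermitian q H) (fr : frame H P e u1 u2).
Local Notation Phi := (frame_comb P e u1 u2).

Lemma herm_frame v w : herm H (Phi v) (Phi w) =
  v.1.1.1 * cj w.1.1.2 + v.1.1.2 * cj w.1.1.1 + v.1.2 * cj w.1.2 + v.2 * cj w.2.
Proof.
rewrite /frame_comb !(hermDl, hermDr hH, hermZl, hermZr hH).
by case: fr => -[-> -> -> ->] [-> -> -> ->] [-> -> -> ->] [-> -> -> ->]; ring.
Qed.

Lemma hform_frame t s x y : hform q H (Phi (t, s, x, y)) = Tr (t * cj s) + N x + N y.
Proof. by rewrite -hermE herm_frame /Tr /N /= !cjE; ring. Qed.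

Lemma frame_inj : injective Phi.
Proof.
move=> v w vw.
have h1 u : herm H (Phi v) (Phi u) = herm H (Phi w) (Phi u) by rewrite vw.
move: (h1 (0, 1, 0, 0)) (h1 (1, 0, 0, 0)) (h1 (0, 0, 1, 0)) (h1 (0, 0, 0, 1)).
rewrite !herm_frame /= !cj0 !cj1 !(mulr0, mulr1, addr0, add0r).
by case: v w {vw h1} => [[[? ?] ?] ?] [[[? ?] ?] ?] /= -> -> -> ->.
Qed.

End Frame.

(** * Polarization and tangent planes of the quadric *)

Section QuadraticForm.
Variable A : 'M[F]_4.

Definition polar (v w : 'rV[F]_4) : F :=
  \sum_i \sum_j A i j * (v 0 i * w 0 j + w 0 i * v 0 j).

Lemma polarC v w : polar v w = polar w v.
Proof. by apply: eq_bigr => i _; apply: eq_bigr => j _; rewrite addrC. Qed.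

Lemma polarDl v w z : polar (v + w) z = polar v z + polar w z.
Proof.
rewrite -big_split; apply: eq_bigr => i _; rewrite -big_split; apply: eq_bigr => j _.
by rewrite !mxE /=; ring.
Qed.

Lemma polarZl l v z : polar (l *: v) z = l * polar v z.
Proof.
rewrite big_distrr; apply: eq_bigr => i _; rewrite big_distrr; apply: eq_bigr => j _.
by rewrite !mxE /=; ring.
Qed.

Lemma polarZr l v z : polar z (l *: v) = l * polar z v.
Proof. by rewrite polarC polarZl (polarC z). Qed.

Lemma qformD v w : qform A (v + w) = qform A v + qform A w + polar v w.
Proof.
rewrite -!big_split; apply: eq_bigr => i _; rewrite -!big_split; apply: eq_bigr => j _.
by rewrite /Defs.coord !mxE /=; ring.
Qed.

Lemma qformZ l v : qform A (l *: v) = l ^+ 2 * qform A v.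
Proof.
rewrite big_distrr; apply: eq_bigr => i _; rewrite big_distrr; apply: eq_bigr => j _.
by rewrite /Defs.coord !mxE /=; ring.
Qed.

(** This is how the tangency hypothesis enters: it removes the terms t x and t y from the quadric
    and gives t s the coefficient [c0]. *)
Lemma polar_tangent (H : 'M[F]_4) P c0 v :
  (forall i, qgrad A P i = c0 * hgrad q H P i) -> polar P v = c0 * herm H v P.
Proof.
move=> tan; transitivity (\sum_i qgrad A P i * v 0 i).
  transitivity (\sum_i \sum_j (A i j * P 0 j * v 0 i) + \sum_i \sum_j (A j i * P 0 j * v 0 i)).
    rewrite [X in _ + X]exchange_big -big_split; apply: eq_bigr => i _.
    by rewrite -big_split; apply: eq_bigr => j _ /=; ring.
  rewrite -big_split; apply: eq_bigr => i _; rewrite -big_split /qgrad big_distrl.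
  by apply: eq_bigr => j _ /=; rewrite /Defs.coord; ring.
rewrite big_distrr; apply: eq_bigr => i _; rewrite tan /hgrad -mulrA; congr (_ * _).
by rewrite big_distrl; apply: eq_bigr => j _ /=; rewrite /Defs.coord -/(cj _); ring.
Qed.

End QuadraticForm.

(** * The common normal form of the two surfaces *)

Section NormalForm.
Variables (H A : 'M[F]_4) (Phi : F * F * F * F -> 'rV[F]_4) (c0 a b c d e f : F).

(** Both surfaces contain (1, 0, 0, 0) with tangent plane s = 0, and [c0] is the ratio of their
    gradients there. *)
Definition normal_coordinates :=
  [/\ c0 != 0, bijective Phi,
      (forall t s x y t' s' x' y',
        Phi (t + t', s + s', x + x', y + y') = Phi (t, s, x, y) + Phi (t', s', x', y')) /\
      (forall l t s x y, Phi (l * t, l * s, l * x, l * y) = l *: Phi (t, s, x, y)),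
      forall t s x y, hform q H (Phi (t, s, x, y)) = Tr (t * cj s) + N x + N y
    & forall t s x y, qform A (Phi (t, s, x, y)) =
        c0 * (t * s + f * s ^+ 2 + s * (d * x + e * y) + (a * x ^+ 2 + c * x * y + b * y ^+ 2))].

Hypothesis nc : normal_coordinates.

Lemma normal_coordinates0 : Phi (0, 0, 0, 0) = 0.
Proof. by case: nc => _ _ [_ /(_ 0 0 0 0 0)]; rewrite mul0r scale0r. Qed.

Lemma n_common_points_normal :
  n_common_points q H A = (ncount a b c d e f + 1 + q ^ 2 * kcount a b c)%N.
Proof.
case: (nc) => c00 [Psi PhiK PsiK] _ hE qE.
have q1 := q_gt1; rewrite /n_common_points hF.
set S := [set v | _].
(* Adding the zero vector gives a sum over all coordinates; the division by q^2 - 1 is then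
   exact. *)
suff : (1 + #|S| = 1 + (ncount a b c d e f + 1 + q ^ 2 * kcount a b c) * (q ^ 2 - 1))%N.
  by move=> /addnI ->; rewrite mulnK // subn_gt0 -{1}(exp1n 2) ltn_exp2r.
rewrite -count_normal_form.
transitivity (\sum_v ((hform q H v == 0) && (qform A v == 0))%R)%N.
  rewrite (bigD1 (0 : 'rV[F]_4)) //= -sum1_card; congr addn.
    by rewrite -normal_coordinates0 hE qE !(mulr0, mul0r, expr0n, addr0, Tr0, N0) eqxx.
  rewrite big_mkcond [RHS]big_mkcond; apply: eq_bigr => v _.
  by rewrite inE -andbA; case: (v != 0) => //=; case: (_ && _).
rewrite (reindex Phi); last by exists Psi => v _.
rewrite [RHS]exchange_big !pair_big; apply: eq_bigr => -[[[t s] x] y] _ /=.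
by rewrite hE qE mulf_eq0 (negPf c00).
Qed.

Definition no_singular_line := forall v w : 'rV[F]_4,
  (forall k l, qform A (k *: v + l *: w) = 0) ->
  exists k l, (k, l) != 0 /\ k *: v + l *: w = 0.

(** A nontrivial zero (x, y) would span with (1, 0, 0, 0) a line of the quadric inside the tangent
    plane. *)
Lemma no_singular_line_anisotropic : no_singular_line ->
  forall x y, a * x ^+ 2 + c * x * y + b * y ^+ 2 = 0 -> (x, y) = 0.
Proof.
case: (nc) => c00 Phi_bij [PhiD PhiZ] hE qE nsl x y g0.
have Phi_comb k l : k *: Phi (1, 0, 0, 0) + l *: Phi (0, 0, x, y) = Phi (k, 0, l * x, l * y).
  by rewrite -!PhiZ -PhiD !mulr0 mulr1 !addr0 !add0r.
have [|k [l [kl0]]] := nsl (Phi (1, 0, 0, 0)) (Phi (0, 0, x, y)).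
  move=> k l; rewrite Phi_comb qE.
  have -> : k * 0 + f * 0 ^+ 2 + 0 * (d * (l * x) + e * (l * y)) + (a * (l * x) ^+ 2 +
    c * (l * x) * (l * y) + b * (l * y) ^+ 2)
    = l ^+ 2 * (a * x ^+ 2 + c * x * y + b * y ^+ 2) by ring.
  by rewrite g0 !mulr0.
rewrite Phi_comb -normal_coordinates0 => /(bij_inj Phi_bij) [k0 /eqP lx /eqP ly].
have l0 : l != 0 by apply: contraNneq kl0 => ->; rewrite k0.
by move: lx ly; rewrite !mulf_eq0 (negPf l0) /= => /eqP -> /eqP ->.
Qed.

(** The radical of the polar form, phrased through [qform] so that canonical equations can be
    substituted directly. *)
Definition in_radical (v : 'rV[F]_4) := forall w, qform A (v + w) = qform A v + qform A w.

Lemma radical_c_neq0 : (forall v, in_radical v -> v = 0) -> c != 0.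
Proof.
case: (nc) => c00 [Psi PhiK PsiK] [PhiD PhiZ] hE qE rad0.
apply/negP => /eqP cz.
(* The first entry d cancels the polar term coming from s d x, so for c = 0 this vector lies in the
   radical. *)
have : Phi (d, 0, 1, 0) = 0.
  apply: rad0 => w; rewrite -(PsiK w); case: (Psi w) => [[[t s] x] y].
  rewrite -PhiD !qE cz; char2.
rewrite -normal_coordinates0 => /(can_inj PhiK) [_ /eqP]; by rewrite oner_eq0.
Qed.

(** Radical vectors have s = 0 and c x = c y = 0. If c were nonzero, x, y and the value of the form
    would vanish; with c = 0 that value is [c0] (a x^2 + b y^2). *)
Lemma radical_c_eq0 v : in_radical v -> qform A v != 0 -> c = 0 /\ (a != 0) || (b != 0).
Proof.
case: (nc) => c00 [Psi PhiK PsiK] [PhiD PhiZ] hE qE; rewrite -(PsiK v).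
case: (Psi v) => [[[t s] x] y] rad.
have rad' t' s' x' y' : t * s' + t' * s + s * (d * x' + e * y') + s' * (d * x + e * y) +
  c * (x * y' + x' * y) = 0.
  apply: (mulfI c00); rewrite mulr0.
  have := rad (Phi (t', s', x', y')); rewrite -PhiD !qE => /eqP.
  rewrite -addr_eq0_char2 => /eqP <-; char2.
have s0 : s = 0 by rewrite -(rad' 1 0 0 0); ring.
have cx : c * x = 0 by rewrite -(rad' 0 0 0 1) s0; ring.
have cy : c * y = 0 by rewrite -(rad' 0 0 1 0) s0; ring.
rewrite qE s0 => Q0.
have c_eq0 : c = 0.
  apply/eqP; apply: contraNT Q0 => c_neq0.
  move/eqP: cx; move/eqP: cy; rewrite !mulf_eq0 (negPf c_neq0) /= => /eqP -> /eqP ->.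
  by apply/orP; right; apply/eqP; ring.
split=> //; rewrite -negb_and; apply: contra Q0 => /andP [/eqP -> /eqP ->].
by rewrite c_eq0; apply/eqP; ring.
Qed.

End NormalForm.

Lemma exists_normal_coordinates (H A : 'M[F]_4) (P : 'rV[F]_4) :
  nondeg_hermitian q H -> hform q H P = 0 -> P != 0 -> qform A P = 0 ->
  same_tangent_plane q H A P ->
  exists Phi c0 a b c d e f, normal_coordinates H A Phi c0 a b c d e f.
Proof.
move=> hH PP P0 QP [c0 [c00 tan]].
have [e [u1 [u2 fr]]] := exists_frame hH P0 PP.
exists (frame_comb P e u1 u2), c0, (qform A u1 / c0), (qform A u2 / c0), (polar A u1 u2 / c0),
  (polar A e u1 / c0), (polar A e u2 / c0), (qform A e / c0).
split => //.
- apply: inj_card_bij; first exact: frame_inj hH fr.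
  by rewrite card_rV4 !card_prod hF -!expnD.
- split; first by move=> t s x y t' s' x' y'; rewrite -frame_combD.
  by move=> l t s x y; rewrite -(frame_combZ _ _ _ _ l (t, s, x, y)).
- exact: hform_frame hH fr.
move=> t s x y;
  rewrite /frame_comb /= !qformD !qformZ !polarDl !polarZl !polarZr !(polar_tangent _ tan) QP.
by case: fr => _ [-> _ _ _] [-> _ _ _] [-> _ _ _]; field.
Qed.

(** * Invariants of the canonical quadrics in characteristic 2 *)

Definition rv4 (t s x y : F) : 'rV[F]_4 := \row_i nth 0 [:: t; s; x; y] i.

Lemma x_rv4 t s x y : [/\ x_ (rv4 t s x y) 0 = t, x_ (rv4 t s x y) 1 = s,
  x_ (rv4 t s x y) 2 = x & x_ (rv4 t s x y) 3 = y].
Proof. by split; rewrite /x_ /Defs.coord mxE inordK. Qed.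

Lemma x_D (v w : 'rV[F]_4) k : x_ (v + w) k = x_ v k + x_ w k.
Proof. by rewrite /x_ /Defs.coord mxE. Qed.

Lemma x_Z l (v : 'rV[F]_4) k : x_ (l *: v) k = l * x_ v k.
Proof. by rewrite /x_ /Defs.coord mxE. Qed.

Lemma x_eq0 (v : 'rV[F]_4) : x_ v 0 = 0 -> x_ v 1 = 0 -> x_ v 2 = 0 -> x_ v 3 = 0 -> v = 0.
Proof.
move=> h0 h1 h2 h3; apply/matrixP => i j; rewrite ord1 mxE -(inord_val j).
by case: j => -[|[|[|[|]]]].
Qed.

Lemma hyperbolic_radical (A : 'M[F]_4) v : hyperbolic_quadric A -> in_radical A v -> v = 0.
Proof.
move=> [M [k [uM [k0 can]]]].
have -> : v = (v *m invmx M) *m M by rewrite mulmxKV.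
move: (v *m invmx M) => {}v rad.
have B t s x y : x_ v 0 * s + x_ v 1 * t + (x_ v 2 * y + x_ v 3 * x) = 0.
  apply: (mulfI k0); rewrite mulr0; have := rad (rv4 t s x y *m M).
  rewrite -mulmxDl !can !x_D; have [-> -> -> ->] := x_rv4 t s x y => /eqP.
  by rewrite -addr_eq0_char2 => /eqP <-; char2.
rewrite (x_eq0 (v := v)) ?mul0mx //.
- by rewrite -(B 0 1 0 0); ring.
- by rewrite -(B 1 0 0 0); ring.
- by rewrite -(B 0 0 0 1); ring.
- by rewrite -(B 0 0 1 0); ring.
Qed.

(** The witness is the nucleus of the base conic: a square contributes nothing to the polar form in
    characteristic 2. *)
Lemma cone_radical (A : 'M[F]_4) : quadratic_cone A ->
  exists2 v, in_radical A v & qform A v != 0.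
Proof.
move=> [M [k [uM [k0 can]]]]; exists (rv4 0 0 1 0 *m M); have [e0 e1 e2 e3] := x_rv4 0 0 1 0.
  move=> w; rewrite -(mulmxKV uM w) -mulmxDl !can !x_D e0 e1 e2; char2.
by rewrite can e0 e1 e2 mul0r add0r expr1n mulr1.
Qed.

(** A singular line has nonzero vectors with first, respectively second, coordinate 0. Anisotropy
    kills their last two coordinates, and singularity of their sum makes one of them zero. *)
Lemma elliptic_no_singular_line (A : 'M[F]_4) : elliptic_quadric A -> no_singular_line A.
Proof.
move=> [del [irr [M [k [uM [k0 can]]]]]] v w.
have aniso x y : x ^+ 2 + x * y + del * y ^+ 2 = 0 -> x = 0 /\ y = 0.
  move=> e1; have [y0|y0] := eqVneq y 0.
    by move: e1; rewrite y0 !(expr0n, mulr0, addr0) => /eqP; rewrite sqrf_eq0 => /eqP.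
  have rt : root ('X^2 + 'X + del%:P) (x / y).
    rewrite rootE !hornerE; apply/eqP; apply: (mulfI (expf_neq0 2 y0)).
    by rewrite mulr0 -e1; field.
  have sp : size ('X^2 + 'X + del%:P : {poly F}) = 3%N.
    rewrite -addrA size_polyDl size_polyXn // ltnS.
    by apply: leq_trans (size_polyD _ _) _;
      rewrite geq_max size_polyX (leq_trans (size_polyC_leq1 _)).
  case: irr => _ /(_ ('X - (x / y)%:P)); rewrite size_XsubC dvdp_XsubCl => /(_ isT rt) /eqp_size.
  by rewrite size_XsubC sp.
have -> : v = (v *m invmx M) *m M by rewrite mulmxKV.
have -> : w = (w *m invmx M) *m M by rewrite mulmxKV.
move: (v *m invmx M) (w *m invmx M) => {}v {}w sing.
pose z r := r.1 *: v + r.2 *: w.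
have sing_z r : x_ (z r) 0 * x_ (z r) 1 + (x_ (z r) 2 ^+ 2 + x_ (z r) 2 * x_ (z r) 3 +
  del * x_ (z r) 3 ^+ 2) = 0.
  apply: (mulfI k0); rewrite mulr0 -(sing r.1 r.2) !scalemxAl -mulmxDl can; ring.
have [r|nz] := pickP (fun r : F * F => (r != 0) && (z r == 0)).
  case: r => r1 r2 /andP [r0 /eqP z0]; exists r1, r2; split=> //.
  by rewrite !scalemxAl -mulmxDl -[_ + _]/(z (r1, r2)) z0 mul0mx.
(* Combining v and w with each other's j-th coordinates gives twice a product, which is 0. *)
have vanish j : exists2 r, r != 0 & x_ (z r) j = 0.
  have [/andP [/eqP v0 /eqP w0]|] := boolP ((x_ v j == 0) && (x_ w j == 0)).
    exists (1, 0); first by apply/eqP => -[/eqP]; rewrite oner_eq0.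
    by rewrite x_D !x_Z v0 mul0r mulr0 addr0.
  rewrite negb_and => h1; exists (x_ w j, x_ v j); last by rewrite x_D !x_Z /= mulrC addxx.
  by apply: contraTneq h1 => -[-> ->]; rewrite eqxx.
have [r r0 zr] := vanish 0%N; have [r' r'0 zr'] := vanish 1%N.
have z0 : z r != 0 by move: (nz r); rewrite r0 => /negbT.
have z'0 : z r' != 0 by move: (nz r'); rewrite r'0 => /negbT.
have [z2 z3] : x_ (z r) 2 = 0 /\ x_ (z r) 3 = 0.
  by apply: aniso; rewrite -[RHS](sing_z r) zr mul0r add0r.
have [z'2 z'3] : x_ (z r') 2 = 0 /\ x_ (z r') 3 = 0.
  by apply: aniso; rewrite -[RHS](sing_z r') zr' mulr0 add0r.
have := sing_z (r + r').
have -> : z (r + r') = z r + z r' by rewrite /z /= !scalerDl addrACA.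
rewrite !(x_D (z r)) zr zr' z2 z3 z'2 z'3 !(add0r, addr0, expr0n, mulr0) => /eqP.
rewrite mulf_eq0 => /orP [] /eqP h1.
- by case/eqP: z'0; apply: x_eq0.
- by case/eqP: z0; apply: x_eq0.
Qed.

(** * Possible sizes by type of quadric *)

Section Sizes.
Variables a b c d e f : F.
Local Notation npoints := (ncount a b c d e f + 1 + q ^ 2 * kcount a b c)%N.

(** These inequalities let [lia] treat q^2 and q^3 as atoms and handle the truncated subtractions in
    the lists. *)
Lemma expn_q_bounds : (2 <= q /\ 2 * q <= q ^ 2 /\ q ^ 3 = q * q ^ 2 /\ 2 * q ^ 2 <= q ^ 3)%N.
Proof. by have := q_gt1; rewrite !expnS expn0 !muln1; nia. Qed.

Ltac pick_disjunct := lazymatch goal with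
  | |- is_true (_ || _) => first [ apply/orP; left; apply/eqP; lia | apply/orP; right;
    pick_disjunct ]
  | |- _ => apply/eqP; lia
  end.

Ltac pick_size := repeat match goal with
  | |- _ \/ _ -> _ => case
  | |- or3 _ _ _ -> _ => case
  | |- _ /\ _ -> _ => case
  | |- _ = _ -> _ => move=> ?
  end; intros; pick_disjunct.

(** A root m counted by [kcount] would give the zero (1, m), so [kcount] is 0; likewise
    [rho0_isotropic] excludes [rho = 0]. *)
Lemma elliptic_sizes : (forall x y, a * x ^+ 2 + c * x * y + b * y ^+ 2 = 0 -> (x, y) = 0) ->
  npoints \in [:: q^3 - q^2 + 1; q^3 - q^2 + q + 1; q^3 - q + 1; q^3 + 1;
               q^3 + q + 1; q^3 + q^2 - q + 1; q^3 + q^2 + 1]%N.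
Proof.
move=> aniso; have k0 : kcount a b c = 0%N.
  case: (posnP (kcount a b c)) => // /kcount_gt0 [m [Nm hm]].
  have [/eqP] : (1, m) = 0 :> F * F by apply: aniso; rewrite -[RHS]hm; ring.
  by rewrite oner_eq0.
rewrite k0 muln0 addn0; have [q2 [q22 [_ q32]]] := expn_q_bounds.
have [Nc|Nc] := eqVneq (N c) 1; last first.
  move: (ncount_nondegenerate a b d e f Nc); rewrite !inE.
  by move: (ncount _ _ _ _ _ _) (q ^ 2)%N (q ^ 3)%N q22 q32 => n u v h1 h2; pick_size.
have rho0 : rho a b c != 0.
  apply/eqP => /(rho0_isotropic Nc) [x [y [xy0 /aniso xy]]].
  by rewrite xy eqxx in xy0.
have [_ [r r2]] := ncount_rho d e f Nc rho0; rewrite !inE.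
by case: r r2 => [|[|[|]]] //;
  move: (ncount _ _ _ _ _ _) (q ^ 2)%N (q ^ 3)%N q22 q32 => n u v h1 h2; pick_size.
Qed.

(** Since N(c) = 0, only the nondegenerate case occurs, with at most one common line. *)
Lemma cone_sizes : c = 0 -> (a != 0) || (b != 0) ->
  npoints \in [:: q^3 - q^2 + q + 1; q^3 - q + 1; q^3 + q + 1;
               q^3 + q^2 - q + 1; q^3 + 2*q^2 - q + 1]%N.
Proof.
move=> c0 ab; have := kcount_le1 c0 ab.
have Nc : N c != 1 by rewrite c0 N0 eq_sym oner_eq0.
have [q2 [q22 [_ q32]]] := expn_q_bounds.
move: (ncount_nondegenerate a b d e f Nc); rewrite !inE.
move: (ncount _ _ _ _ _ _) (kcount a b c) => n k hn hk.
have [k0|k1] : k = 0%N \/ k = 1%N by lia.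
  by rewrite k0 in hn *; move: (q ^ 2)%N (q ^ 3)%N q22 q32 hn => u v h1 h2; pick_size.
by rewrite k1 in hn *; move: (q ^ 2)%N (q ^ 3)%N q22 q32 hn => u v h1 h2; pick_size.
Qed.

(** All branches can occur here. The second alternative of [ncount_rho0] gives q^2 + 1 for [kcount]
    0 and 2q^3 + q^2 + 1 for [kcount] 2. *)
Lemma hyperbolic_sizes : c != 0 ->
  npoints \in [:: q^2 + 1; q^3 - q^2 + 1; q^3 - q^2 + q + 1; q^3 - q + 1; q^3 + 1;
               q^3 + q + 1; q^3 + q^2 - q + 1; q^3 + q^2 + 1; q^3 + 2*q^2 - q + 1;
               q^3 + 2*q^2 + 1; q^3 + 3*q^2 - q + 1; 2*q^3 + q^2 + 1]%N.
Proof.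
move=> c0; have [q2 [q22 [q3 q32]]] := expn_q_bounds.
have k2 : (kcount a b c <= 2)%N by apply: kcount_le2; rewrite c0 !orbT.
have [Nc|Nc] := eqVneq (N c) 1; last first.
  move: (ncount_nondegenerate a b d e f Nc); rewrite !inE.
  move: (ncount _ _ _ _ _ _) (kcount a b c) k2 => n k hk hn.
  have [k0|[k0|k0]] : k = 0%N \/ k = 1%N \/ k = 2%N by lia.
  - by rewrite k0 in hn *; move: (q ^ 2)%N (q ^ 3)%N {q3} q22 q32 hn => u v h1 h2; pick_size.
  - by rewrite k0 in hn *; move: (q ^ 2)%N (q ^ 3)%N {q3} q22 q32 hn => u v h1 h2; pick_size.
  - by rewrite k0 in hn *; move: (q ^ 2)%N (q ^ 3)%N {q3} q22 q32 hn => u v h1 h2; pick_size.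
have [rho0|rho0] := eqVneq (rho a b c) 0.
  have [hk hn] := ncount_rho0 d e f Nc rho0; rewrite !inE.
  move: (ncount _ _ _ _ _ _) (kcount a b c) {k2} hk hn => n k hk hn.
  (* The product with q - 1 is rewritten without subtraction so that the cases become linear in q^2
     and q^3. *)
  have hn' : [\/ n = q ^ 3, n + (q ^ 2 * k) = q ^ 2 + k * q ^ 3 | n + q ^ 2 * k = q ^ 3 + q ^ 2]%N.
    case: hn => hn; [by constructor 1 | constructor 2 | constructor 3]; move: hn; rewrite q3.
      by move: (q ^ 2)%N => q' ->; case: (q) q2 => // p _; rewrite subSS subn0; ring.
    by move->; ring.
  case: hk => k0; rewrite k0 in hn' *; move: (q ^ 2)%N (q ^ 3)%N {q3 hn} q22 q32 hn' => u v h1 h2;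
    pick_size.
have [k1 [r r2]] := ncount_rho d e f Nc rho0; rewrite !inE.
move: (ncount _ _ _ _ _ _) (kcount a b c) k1 {k2} => n k k1 hn.
have [k0|k0] : k = 0%N \/ k = 1%N by lia.
  by rewrite k0; case: r r2 hn => [|[|[|]]] // _;
    move: (q ^ 2)%N (q ^ 3)%N {q3} q22 q32 => u v h1 h2; pick_size.
by rewrite k0; case: r r2 hn => [|[|[|]]] // _;
  move: (q ^ 2)%N (q ^ 3)%N {q3} q22 q32 => u v h1 h2; pick_size.
Qed.

End Sizes.

End HermitianCounts.


Theorem theorem1 (F : finFieldType) (q h : nat)
  (hq : q = (2 ^ h)%N) (hF : #|F| = (q ^ 2)%N)
  (H A : 'M[F]_4) (P : 'rV[F]_4)
  (hH : nondeg_hermitian q H)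
  (hQ : irreducible_quadric A)
  (hPH : hform q H P = 0)
  (hPQ : nonsingular_qpoint A P)
  (htan : same_tangent_plane q H A P) :
  let N := n_common_points q H A in
  (elliptic_quadric A ->
     N \in [:: q^3 - q^2 + 1; q^3 - q^2 + q + 1; q^3 - q + 1; q^3 + 1;
               q^3 + q + 1; q^3 + q^2 - q + 1; q^3 + q^2 + 1]%N) /\
  (quadratic_cone A ->
     N \in [:: q^3 - q^2 + q + 1; q^3 - q + 1; q^3 + q + 1;
               q^3 + q^2 - q + 1; q^3 + 2*q^2 - q + 1]%N) /\
  (hyperbolic_quadric A ->
     N \in [:: q^2 + 1; q^3 - q^2 + 1; q^3 - q^2 + q + 1; q^3 - q + 1; q^3 + 1;
               q^3 + q + 1; q^3 + q^2 - q + 1; q^3 + q^2 + 1; q^3 + 2*q^2 - q + 1;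
               q^3 + 2*q^2 + 1; q^3 + 3*q^2 - q + 1; 2*q^3 + q^2 + 1]%N).
Proof.
have [P0 [QP _]] := hPQ.
have [Phi [c0 [a [b [c [d [e [f nc]]]]]]]] := exists_normal_coordinates hq hF hH hPH P0 QP htan.
rewrite /= (n_common_points_normal hq hF nc); split; [|split] => quadric.
- apply: (elliptic_sizes hq hF); apply: (no_singular_line_anisotropic nc).
  exact: (elliptic_no_singular_line hq hF quadric).
- have [v rad Qv] := cone_radical hq hF quadric.
  have [c_eq0 ab] := radical_c_eq0 hq hF nc rad Qv.
  exact: (cone_sizes hq hF).
- apply: (hyperbolic_sizes hq hF); apply: (radical_c_neq0 hq hF nc) => v.
  exact: (hyperbolic_radical hq hF quadric).
Qed.
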